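(* Let $D=(V,A)$ be a digraph, $k$ a positive integer and $c:A\to\mathbb{R}$ a cost function. The convex hull of the root vectors of the minimum cost $k$-arborescences of $D$ is a base polyhedron.
   Context: A spanning arborescence is an arc set forming a spanning tree in the undirected sense with every node of in-degree at most one; a $k$-arborescence is the disjoint union of $k$ spanning arborescences. The root vector of a $k$-arborescence $F$ is $q\in\mathbb{Z}_+^V$ with $q(v)$ the number of arborescences (in a decomposition of $F$) rooted at $v$; equivalently $q(v)=k-\varrho_F(v)$, where $\varrho_F(v)$ is the number of arcs of $F$ entering $v$. A base polyhedron on ground set $V$ is a polyhedron of the form $\{x\in\mathbb{R}^V: x(V)=b(V),\ x(Z)\le b(Z)\ \forall Z\subseteq V\}$ for a submodular function $b$ (equivalently $\{x: x(V)=p(V),\ x(Z)\ge p(Z)\ \forall Z\}$ for a supermodular $p$), where $x(Z)=\sum_{v\in Z}x(v)$. *)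

(* Defs.v *)
From mathcomp Require Import all_boot all_order all_algebra.
From mathcomp Require Import classical_sets reals convex.

Set Implicit Arguments.
Unset Strict Implicit.
Unset Printing Implicit Defensive.

Import Order.TTheory GRing.Theory Num.Theory.

Local Open Scope ring_scope.

(* Parallel arcs and loops are allowed. *)
Record digraph (V A : finType) := Digraph { tail : A -> V; head : A -> V }.

Section Arborescences.
Variables (V A : finType) (D : digraph V A).

Definition joins (a : A) : rel V := fun u v =>
  ((tail D a == u) && (head D a == v)) || ((tail D a == v) && (head D a == u)).

Definition adjacent (B : {set A}) : rel V := fun u v =>
  [exists a in B, joins a u v].

Definition connected_arcs (B : {set A}) : Prop :=
  (0 < #|V|)%N /\ forall u v : V, connect (adjacent B) u v.

(* [:: (v_1, a_1); ...; (v_n, a_n)], with distinct vertices v_i and distinct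
   arcs a_i in B, such that a_i joins v_i to v_(i+1) in the undirected sense
   and a_n joins v_n to v_1: for n = 1 this is a loop, for n = 2 a pair of
   parallel or opposite arcs. *)
Definition undirected_cycle (B : {set A}) (s : seq (V * A)) : Prop :=
  [/\ s != [::], uniq [seq x.1 | x <- s], uniq [seq x.2 | x <- s],
      all (fun x : V * A => x.2 \in B) s
    & cycle (fun x y : V * A => joins x.2 x.1 y.1) s].

Definition spanning_tree (B : {set A}) : Prop :=
  connected_arcs B /\ forall s, ~ undirected_cycle B s.

Definition indegree (B : {set A}) (v : V) : nat :=
  #|[set a in B | head D a == v]%SET|.

Definition spanning_arborescence (B : {set A}) : Prop :=
  spanning_tree B /\ forall v, (indegree B v <= 1)%N.

Definition is_root (B : {set A}) (v : V) : bool := indegree B v == 0%N.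

Definition arborescence_decomposition (k : nat) (F : {set A})
    (B : 'I_k -> {set A}) : Prop :=
  [/\ forall i, spanning_arborescence (B i),
      forall i j, i != j -> [disjoint B i & B j]
    & F = (\bigcup_(i < k) B i)%SET].

Definition k_arborescence (k : nat) (F : {set A}) : Prop :=
  exists B : 'I_k -> {set A}, arborescence_decomposition F B.

Definition cost (R : realType) (c : A -> R) (F : {set A}) : R :=
  \sum_(a in F) c a.

Definition min_cost_k_arborescence (R : realType) (k : nat) (c : A -> R)
    (F : {set A}) : Prop :=
  k_arborescence k F /\
  forall F' : {set A}, k_arborescence k F' -> cost c F <= cost c F'.

(* R^o is R as a module over itself, so that {ffun V -> R^o} is the vector
   space R^V. *)
Definition root_vector (R : realType) (k : nat) (F : {set A})
    (q : {ffun V -> R^o}) : Prop :=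
  exists2 B : 'I_k -> {set A}, arborescence_decomposition F B
    & forall v, q v = #|[set i | is_root (B i) v]%SET|%:R.

Definition min_cost_root_vectors (R : realType) (k : nat) (c : A -> R) :
    set {ffun V -> R^o} :=
  [set q | exists2 F : {set A}, min_cost_k_arborescence k c F
             & root_vector k F q]%classic.

End Arborescences.

Definition convex_hull (R : realType) (E : lmodType R) (S : set E) : set E :=
  smallest (fun C : set E => convex_set C) S.

Definition submodular (R : realType) (V : finType) (b : {set V} -> R) : Prop :=
  forall X Y : {set V}, b (X :&: Y)%SET + b (X :|: Y)%SET <= b X + b Y.

Definition base_polyhedron_of (R : realType) (V : finType)
    (b : {set V} -> R) : set {ffun V -> R^o} :=
  [set x | \sum_v x v = b [set: V]%SET /\
           forall Z : {set V}, \sum_(v in Z) x v <= b Z]%classic.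

(* The value of b on the empty set is not fixed. If the polyhedron is nonempty,
   that value is nonnegative and resetting it to 0 changes neither the
   polyhedron nor submodularity, so this agrees with the normalization in which
   b vanishes on the empty set; the only additional base polyhedron is the
   empty one. *)
Definition base_polyhedron (R : realType) (V : finType)
    (P : set {ffun V -> R^o}) : Prop :=
  exists2 b : {set V} -> R, submodular b & P = base_polyhedron_of b.

(* Main.v *)
(* The root vector of a k-arborescence F is q(v) = k - (in-degree of v in F),
   and by Edmonds' theorem the k-arborescences are the common independent sets
   of size k(|V| - 1) of two matroids: the k-fold union of the graphic matroid,
   with rank function r, and the matroid "in-degrees at most k".

   A polyhedron with submodular upper bounds is the convex hull of S as soon as
   for every chain of subsets of V some point of S maximizes all the sums over
   the members of the chain simultaneously (greedy algorithm).  To find it,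
   take a k-arborescence F minimizing first the cost and then the sum of the
   in-degrees of the members of the chain; since the polytope
   {x(T) <= r(T), x(A) = r(A), in-degrees <= k} has integral vertices, F is
   optimal in it as well.  Shortest walks of infinitesimal exchanges e -> f give
   a weight splitting p >= 0 on V, vanishing off the saturated vertices, such
   that F minimizes c + p over the base polytope of r.  Given a member Z of the
   chain, let W be the set of vertices reachable from the u in Z with p(u) = 0
   by exchanges preserving c + p.  Then F also minimizes c + p + d [head in W]
   for small d > 0, so the in-degree of W is minimal; W \ Z is saturated by the
   choice of F, and Z \ W is saturated in every optimal solution because p is
   positive there.  Hence the in-degree of Z is minimal too. *)

Require Import Defs.
From mathcomp Require Import all_boot all_order all_algebra.
From mathcomp Require Import classical_sets reals convex.
From mathcomp Require Import boolp interval_inference zify ring lra.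
(* Restores the names shared with [classical_sets] and the [tail] of digraphs. *)
From mathcomp Require Import fintype finset.
Require Import Defs.

Set Implicit Arguments.
Unset Strict Implicit.
Unset Printing Implicit Defensive.

Import Order.TTheory GRing.Theory Num.Theory.

Local Open Scope ring_scope.

(** * Polyhedra and base polyhedra *)

Section Polyhedra.
Variables (R : realFieldType) (E : lmodType R) (J : finType).
Variables (l : J -> E -> R) (b : J -> R).
Hypothesis linl : forall j x y t, l j (x + t *: y) = l j x + t * l j y.

(** A ratio test: only constraints growing along [y] can stop the motion, and these have positive
    slack at [x]. The least quotient of slack by slope is a positive step that makes one of them
    tight. *)
Lemma feasible_step x y :
    (forall j, l j x <= b j) -> (forall j, l j x = b j -> l j y <= 0) ->
  exists t, [/\ 0 < t, forall j, l j (x + t *: y) <= b j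
    & (exists j, 0 < l j y) ->
      exists j, 0 < l j y /\ l j (x + t *: y) = b j].
Proof.
move=> xP yT; case: (pickP (fun j => 0 < l j y)) => [j0 j0y|noj]; last first.
  exists 1; split=> // [j|[j]]; last by rewrite noj.
  rewrite linl mul1r -[b j]addr0 lerD ?xP // leNgt; apply/negP => jy.
  by move: (noj j); rewrite jy.
case: (@arg_minP _ _ _ j0 (fun j => 0 < l j y)
         (fun j => (b j - l j x) / l j y) j0y) => j jy jmin.
exists ((b j - l j x) / l j y); split=> [|i|_].
- rewrite divr_gt0 // subr_gt0 lt_neqAle xP andbT; apply/eqP => /yT.
  by rewrite leNgt jy.
- rewrite linl -lerBrDl; have [iy|iy] := ltP 0 (l i y).
    by rewrite -ler_pdivlMr // jmin.
  rewrite (@le_trans _ _ 0) ?subr_ge0 // mulr_ge0_le0 // divr_ge0 ?subr_ge0 //.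
  exact: ltW.
- by exists j; split=> //; rewrite linl divfK ?gt_eqF // addrC subrK.
Qed.

Hypothesis l_bounded : forall y, (forall j, l j y <= 0) -> y = 0.

(* A point that is not a vertex lies strictly between two points of the
   polyhedron that satisfy more of the inequalities with equality. *)
Lemma polyhedron_ind (C : E -> Prop) :
    (forall x y t, 0 < t -> t < 1 -> C x -> C y -> C (t *: x + (1 - t) *: y)) ->
    (forall x, (forall j, l j x <= b j) ->
       (forall y, (forall j, l j x = b j -> l j y = 0) -> y = 0) -> C x) ->
  forall x, (forall j, l j x <= b j) -> C x.
Proof.
move=> Cconv Cvert x.
have [n] := ubnP #|[pred j | l j x != b j]|; elim: n x => // n IHn x; rewrite ltnS => lexn xP.
case: (pselect (forall y, (forall j, l j x = b j -> l j y = 0) -> y = 0)).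
  exact: Cvert.
move=> /existsNP[y] /not_implyP[yT /eqP y0].
have l0 j : l j 0 = 0.
  by have /eqP := linl j 0 0 1; rewrite scaler0 addr0 eq_sym mul1r -subr_eq0 addrK => /eqP.
have step z : z != 0 -> (forall j, l j x = b j -> l j z = 0) ->
    exists t, 0 < t /\ C (x + t *: z).
  move=> z0 zT; have [|t [t0 xtP tight]] := feasible_step xP (y := z).
    by move=> j /zT ->.
  exists t; split=> //; apply: IHn => //; apply: leq_trans lexn; apply: proper_card.
  apply/properP; split; first apply/fintype.subsetP => j; rewrite ?inE.
    by apply: contra => /eqP xj; rewrite linl zT // mulr0 addr0 xj.
  have [|j [jz jt]] := tight.
    apply: contrapT => /forallNP noj; case/eqP: z0; apply: l_bounded => j.
    by rewrite leNgt; apply/negP.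
  exists j; rewrite !inE; last by rewrite jt eqxx.
  by apply/eqP => /zT z_j; rewrite z_j ltxx in jz.
have [t [t0 Ct]] := step y y0 yT.
have [|j jT|u [u0 Cu]] := step (- y); first by rewrite oppr_eq0.
  have := linl j 0 y (-1); rewrite scaleN1r add0r => ->.
  by rewrite l0 (yT _ jT) mulr0 addr0.
have tu0 : 0 < t + u by rewrite addr_gt0.
have /(_ (u / (t + u))) := Cconv _ _ _ _ _ Ct Cu.
rewrite divr_gt0 // ltr_pdivrMr // mul1r ltrDr t0 => /(_ isT isT).
congr C; rewrite !scalerDr !scalerA addrACA -scalerDl addrC [u / _ + _]addrC subrK scale1r.
rewrite scalerN -scaleNr -scalerDl [X in X *: y](_ : _ = 0) ?scale0r ?add0r //.
by field; rewrite gt_eqF.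
Qed.

End Polyhedra.

Definition set_chain (V : finType) (CC : {set {set V}}) : Prop :=
  {in CC &, forall X Y : {set V}, (X \subset Y) || (Y \subset X)}.

Lemma big_setT (M : Type) (idx : M) (op : M -> M -> M) (I : finType) (F : I -> M) :
  \big[op/idx]_(i in [set: I]) F i = \big[op/idx]_i F i.
Proof. by apply: eq_bigl => i; rewrite inE. Qed.

Lemma sum_setUI (M : nmodType) (I : finType) (F : I -> M) (X Y : {set I}) :
  \sum_(i in X :&: Y) F i + \sum_(i in X :|: Y) F i =
  \sum_(i in X) F i + \sum_(i in Y) F i.
Proof.
rewrite (@big_setID _ _ _ _ (X :|: Y) X) /= setUK setDUl setDv.
by rewrite set0U addrCA (@big_setID _ _ _ _ Y X) /= setIC.
Qed.

Lemma sum_indicator (R : pzSemiRingType) (I : finType) (Z : {set I}) (u : I) :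
  \sum_(w in Z) (w == u)%:R = (u \in Z)%:R :> R.
Proof.
have [uZ|uZ] := boolP (u \in Z).
  by rewrite (bigD1 u) //= eqxx big1 ?addr0 // => w /andP[_ /negbTE->].
by rewrite big1 // => w wZ; case: eqP => // wu; rewrite wu (negbTE uZ) in wZ.
Qed.

Section BasePolyhedra.
Variables (R : realType) (V : finType).
Implicit Types (q x y : {ffun V -> R^o}) (X Y Z : {set V}).

Lemma base_polyhedron_of_convex (b : {set V} -> R) :
  convex_set (base_polyhedron_of b).
Proof.
apply/convex_setW => x y /set_mem[xV xZ] /set_mem[yV yZ] t t0 t1.
have t1' : 0 <= 1 - t%:num by rewrite subr_ge0 ltW.
have combE Z : \sum_(v in Z) (t%:num *: x + (1 - t%:num) *: y) v =
    t%:num * (\sum_(v in Z) x v) + (1 - t%:num) * (\sum_(v in Z) y v).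
  by rewrite !mulr_sumr -big_split /=; apply: eq_bigr => v _; rewrite !ffunE.
apply/mem_set; suff : base_polyhedron_of b (t%:num *: x + (1 - t%:num) *: y) by [].
split=> [|Z]; last first.
  rewrite combE; apply: le_trans (lerD (ler_wpM2l (ltW t0) (xZ Z)) (ler_wpM2l t1' (yZ Z))) _.
  by rewrite -mulrDl addrC subrK mul1r.
have := combE [set: V]; rewrite !big_setT => ->.
by rewrite xV yV -mulrDl addrC subrK mul1r.
Qed.

(** [X] is the largest member avoiding [v] and [Y] the smallest containing it. If [Y :\: X] had a
    further element, a set [Z] of [T] separating it from [v] would allow inserting [X :|: (Z :&: Y)]
    strictly in between, against maximality. *)
Lemma set_chain_atoms (T CC : {set {set V}}) :
    [set: V] \in T -> set0 \in T ->
    {in T &, forall X Y, (X :&: Y \in T) && (X :|: Y \in T)} ->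
    (forall u v, u != v -> exists2 Z, Z \in T & (u \in Z) != (v \in Z)) ->
    maxset (fun D : {set {set V}} => (D \subset T) && `[< set_chain D >]) CC ->
  forall v, exists X Y, [/\ X \in CC, Y \in CC & Y = v |: X /\ v \notin X].
Proof.
move=> TV T0 TIU sep /maxsetP[/andP[/subsetP CT /asboolP chainC] maxC] v.
have addC Z : Z \in T -> {in CC, forall X, (X \subset Z) || (Z \subset X)} -> Z \in CC.
  move=> ZT ZC; rewrite -(maxC (Z |: CC)) ?setU11 ?subsetUr //.
  apply/andP; split.
    by rewrite subUset sub1set ZT; apply/subsetP.
  apply/asboolP => X Y /setU1P[->|XC] /setU1P[->|YC].
  - by rewrite subxx.
  - by rewrite orbC; exact: ZC.
  - exact: ZC.
  - exact: chainC.
have CV : [set: V] \in CC by apply: addC => // X _; rewrite subsetT.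
have C0 : set0 \in CC by apply: addC => // X _; rewrite sub0set orbT.
pose Y := [arg min_(Y < [set: V] | (Y \in CC) && (v \in Y)) #|Y|].
pose X := [arg max_(X > set0 | (X \in CC) && (v \notin X)) #|X|].
have [YC vY Ymin] : [/\ Y \in CC, v \in Y & forall Z, Z \in CC -> v \in Z -> Y \subset Z].
  rewrite /Y; case: arg_minnP; first by rewrite CV in_setT.
  move=> Z /andP[ZC vZ] Zmin; split=> // Z' Z'C vZ'.
  have /orP[//|Z'Z] := chainC _ _ ZC Z'C.
  by have /eqP-> : Z == Z' by rewrite eq_sym eqEcard Z'Z Zmin // Z'C.
have [XC vX Xmax] : [/\ X \in CC, v \notin X & forall Z, Z \in CC -> v \notin Z -> Z \subset X].
  rewrite /X; case: arg_maxnP; first by rewrite C0 in_set0.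
  move=> Z /andP[ZC vZ] Zmax; split=> // Z' Z'C vZ'.
  have /orP[ZZ'|//] := chainC _ _ ZC Z'C.
  have /eqP<- : Z == Z' by rewrite eqEcard ZZ' /=; apply: Zmax; rewrite Z'C.
  exact: subxx.
have XY : X \subset Y.
  by have /orP[//|/subsetP/(_ v vY)] := chainC _ _ XC YC; rewrite (negbTE vX).
exists X, Y; split=> //; split=> //; apply/setP => u; rewrite in_setU1.
have [->|uv] := eqVneq u v; first by rewrite vY.
apply/idP/idP => /= [uY|]; last exact: (subsetP XY).
apply: contrapT => /negP uX.
have [Z ZT uvZ] := sep _ _ uv.
pose M := X :|: (Z :&: Y).
have YT := CT _ YC; have XT := CT _ XC.
have MC : M \in CC.
  apply: addC => [|W WC].
    by have /andP[ZY _] := TIU _ _ ZT YT; have /andP[] := TIU _ _ XT ZY.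
  have [vW|vW] := boolP (v \in W).
    rewrite subUset (subset_trans _ (Ymin _ WC vW)) //=.
    by rewrite (subset_trans (subsetIr _ _) (Ymin _ WC vW)) orbT.
  by rewrite (subset_trans (Xmax _ WC vW)) // subsetUl.
have uM : (u \in M) = (u \in Z) by rewrite !inE (negbTE uX) uY andbT.
have vM : (v \in M) = (v \in Z) by rewrite !inE (negbTE vX) vY andbT.
have [vZ|vZ] := boolP (v \in Z).
  have := Ymin M MC; rewrite vM => /(_ vZ) /subsetP/(_ _ uY).
  by rewrite uM => uZ; rewrite uZ vZ in uvZ.
have := Xmax M MC; rewrite vM => /(_ vZ) /subsetP/(_ u).
by rewrite uM (negbTE uX) => uZ; move: uvZ; rewrite (negbTE vZ); case: (u \in Z) uZ => // /(_ isT).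
Qed.

(** The bound [b Z] is the maximum of the sum over [Z] on [S]. Two-member chains make it submodular.
    A vertex is determined by a maximal chain of tight sets, so it equals the point of [S] provided
    for that chain. *)
Lemma base_polyhedron_of_chains (S : set {ffun V -> R^o}) (m : R) :
    (forall q, S q -> \sum_v q v = m) ->
    (S !=set0 -> forall CC : {set {set V}}, set_chain CC ->
       exists2 q, S q & forall Z q', Z \in CC -> S q' ->
         \sum_(v in Z) q' v <= \sum_(v in Z) q v)%classic ->
  base_polyhedron (convex_hull S).
Proof.
move=> Sm chainS; case: (pselect (S !=set0)%classic) => [S0|/set0P/negP/negPn/eqP S0]; last first.
  (* For empty [S], the constant bound -1 is violated by every point at the empty set. *)
  exists (fun=> -1) => [X Y //|]; rewrite S0.
  apply/seteqP; split=> [x|x [_ /(_ set0)]]; last by rewrite big_set0 lerNr oppr0 ler10.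
  by move=> /(_ classical_sets.set0) []; split=> // y z t /set_mem[].
have {}chainS := chainS S0.
have /choice[top topP] : forall Z, exists q, S q /\ forall q', S q' ->
    \sum_(v in Z) q' v <= \sum_(v in Z) q v.
  move=> Z; have [|q Sq qZ] := chainS [set Z].
    by move=> X Y /set1P-> /set1P->; rewrite subxx.
  by exists q; split=> // q'; apply: qZ; rewrite inE.
pose b Z := \sum_(v in Z) top Z v.
have bS q Z : S q -> \sum_(v in Z) q v <= b Z by have [_] := topP Z; apply.
have chainb CC : set_chain CC -> exists2 q, S q & forall Z, Z \in CC -> \sum_(v in Z) q v = b Z.
  move=> /chainS[q Sq qC]; exists q => // Z ZC; apply/eqP; rewrite eq_le bS //=.
  by apply: qC => //; have [] := topP Z.
have bV : b [set: V] = m.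
  by have [? _] := topP [set: V]; rewrite /b big_setT Sm.
have subb : submodular b.
  move=> X Y; have [|q Sq qb] := chainb [set X :&: Y; X :|: Y]%SET.
    have XY : X :&: Y \subset X :|: Y.
      exact: subset_trans (subsetIl _ _) (subsetUl _ _).
    by move=> U W /set2P[]-> /set2P[]->; rewrite ?subxx ?XY ?orbT.
  by rewrite -(qb (X :&: Y)) ?set21 // -(qb (X :|: Y)) ?set22 // sum_setUI lerD // bS.
exists b => //; apply/seteqP; split=> x.
  move=> /(_ (base_polyhedron_of b)) /=; apply; split.
    exact: base_polyhedron_of_convex.
  by move=> q Sq; split=> [|Z]; rewrite ?bV ?Sm // bS.
move=> [xV xZ] C [Cconv SC].
(* The index [None] carries the reverse inequality for the total, so that the equality becomes two
   inequalities. *)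
pose l (j : option {set V}) (y : {ffun V -> R^o}) : R :=
  if j is Some Z then \sum_(v in Z) y v else - \sum_v y v.
pose bl j := if j is Some Z then b Z else - b [set: V].
have linl j y z t : l j (y + t *: z) = l j y + t * l j z.
  case: j => [Z|] /=; rewrite ?mulrN -?opprD; last congr (- _).
    by rewrite mulr_sumr -big_split /=; apply: eq_bigr => v _; rewrite !ffunE.
  by rewrite mulr_sumr -big_split /=; apply: eq_bigr => v _; rewrite !ffunE.
apply: (polyhedron_ind linl (b := bl)); last first.
- by case=> [Z|] /=; [exact: xZ|rewrite xV].
- move=> {xV xZ}x xP xvert.
  have xZ Z : \sum_(v in Z) x v <= b Z := xP (Some Z).
  have xV : \sum_(v in [set: V]) x v = b [set: V].
    by apply/eqP; rewrite eq_le xZ /= -lerN2 big_setT; exact: xP None.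
  pose T := [set Z : {set V} | \sum_(v in Z) x v == b Z].
  have b0 : b set0 = 0 by rewrite /b big_set0.
  have T0 : set0 \in T by rewrite inE big_set0 b0.
  have TV : [set: V] \in T by rewrite inE xV.
  have TIU : {in T &, forall X Y, (X :&: Y \in T) && (X :|: Y \in T)}.
    move=> X Y; rewrite !inE => /eqP xX /eqP xY.
    have := subb X Y; rewrite -xX -xY -sum_setUI => le.
    have := xZ (X :&: Y); have := xZ (X :|: Y); rewrite !eq_le => -> -> /=.
    have := xZ (X :&: Y); have := xZ (X :|: Y) => le1 le2; apply/andP; split; lra.
  have sep u v : u != v -> exists2 Z, Z \in T & (u \in Z) != (v \in Z).
    move=> uv; apply: contrapT => nosep.
    have same Z : Z \in T -> (u \in Z) = (v \in Z).
      by move=> ZT; apply: contrapT => /eqP ?; apply: nosep; exists Z.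
    (* If no tight set separates [u] from [v], moving mass from [v] to [u] preserves all tight
       constraints, which a vertex forbids. *)
    pose y : {ffun V -> R^o} := [ffun w => (w == u)%:R - (w == v)%:R].
    have ysum Z : \sum_(w in Z) y w = (u \in Z)%:R - (v \in Z)%:R.
      under eq_bigr do rewrite ffunE.
      by rewrite sumrB !sum_indicator.
    have /ffunP/(_ u) : y = 0.
      apply: xvert => -[Z|] /=.
        by move=> xZb; rewrite ysum same ?subrr // inE xZb.
      by move=> _; rewrite -big_setT ysum !in_setT subrr oppr0.
    by rewrite !ffunE eqxx (negbTE uv) subr0 => /eqP; rewrite oner_eq0.
  pose PC (D : {set {set V}}) := (D \subset T) && `[< set_chain D >].
  have [|CC CCmax _] := @maxset_exists _ PC set0.
    by rewrite /PC sub0set; apply/asboolP => X Y; rewrite inE.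
  have /maxsetP[/andP[/subsetP CT /asboolP/chainb[q Sq qb]] _] := CCmax.
  suff -> : x = q by exact: SC.
  apply/ffunP => v; have [X [Y [XC YC [Yv vX]]]] := set_chain_atoms TV T0 TIU sep CCmax v.
  have := qb Y YC; have := CT _ YC; rewrite inE => /eqP <-.
  rewrite Yv !big_setU1 //= (qb X XC).
  by have := CT _ XC; rewrite inE => /eqP <- /addIr ->.
- move=> y z t t0 t1 Cy Cz; have [t0' t1'] := (ltW t0, ltW t1).
  exact: set_mem (Cconv y z (Itv01 t0' t1') (mem_set Cy) (mem_set Cz)).
- move=> y yneg; have yv v : y v <= 0.
    by have := yneg (Some [set v]); rewrite /= big_set1.
  have := yneg None; rewrite /= lerNl oppr0 => yV.
  apply/ffunP => v; rewrite ffunE; apply/eqP; rewrite eq_le yv /=.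
  by move: yV; rewrite (bigD1 v) //= => /le_trans -> //; rewrite gerDl sumr_le0.
Qed.

End BasePolyhedra.

(** * Vertices of a base polytope with bounded degrees *)

(** The incidence matrix has more rows than columns, so its left kernel has a nonzero row, extended
    by zero outside [D]. *)
Lemma few_constraints (K : fieldType) (E : finType) (D : {set E}) (cs : seq {set E}) :
    (size cs < #|D|)%N ->
  exists y : {ffun E -> K}, [/\ exists e, y e != 0, forall e, e \notin D -> y e = 0
    & forall c, c \in cs -> \sum_(e in c) y e = 0].
Proof.
move=> ltcs.
pose M : 'M[K]_(#|D|, size cs) := \matrix_(i, j) (enum_val i \in nth set0 cs j)%:R.
have /rowV0Pn[v /sub_kermxP vM v0] : kermx M != 0.
  by rewrite -mxrank_eq0 mxrank_ker subn_eq0 -ltnNge (leq_ltn_trans (rank_leq_col M)).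
pose y := [ffun e => \sum_(i < #|D|) v ord0 i * (e == enum_val i)%:R].
exists y; split=> [|e eD|c].
- have /existsP[i vi] : [exists i, v ord0 i != 0].
    apply: contra_neqT v0 => /existsPn v0; apply/rowP => i; rewrite mxE.
    by apply/eqP/negPn/v0.
  exists (enum_val i); rewrite ffunE (bigD1 i) //= eqxx mulr1 big1 ?addr0 // => j ji.
  by rewrite (inj_eq enum_val_inj) eq_sym (negbTE ji) mulr0.
- rewrite ffunE big1 // => i _; case: eqP => [eE|]; rewrite ?mulr0 //.
  by rewrite eE enum_valP in eD.
- move=> /(nthP set0)[j ltj <-]; have /rowP/(_ (Ordinal ltj)) := vM.
  rewrite !mxE => v_j; rewrite -[RHS]v_j.
  rewrite [LHS](eq_bigr _ (fun e _ => ffunE _ e)) /=.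
  rewrite exchange_big /=; apply: eq_bigr => i _; rewrite -mulr_sumr sum_indicator.
  by rewrite mxE.
Qed.

Section BasePolytope.
Variables (R : realType) (A V : finType) (hd : A -> V) (k : nat) (r : {set A} -> nat).
Hypothesis r0 : r set0 = 0%N.
Hypothesis r1 : forall e, (r [set e] <= 1)%N.
Hypothesis rS : forall T U : {set A}, T \subset U -> (r T <= r U)%N.
Hypothesis rIU : forall T U : {set A}, (r (T :&: U) + r (T :|: U) <= r T + r U)%N.

Implicit Types (x y : {ffun A -> R}) (T U F : {set A}).

Definition star (v : V) : {set A} := [set e | hd e == v].

Definition in_base x : Prop :=
  (forall T, \sum_(e in T) x e <= (r T)%:R) /\ \sum_e x e = (r [set: A])%:R.

Definition tight x T : bool := \sum_(e in T) x e == (r T)%:R.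

Lemma tightIU x T U : in_base x -> tight x T -> tight x U ->
  tight x (T :&: U) && tight x (T :|: U).
Proof.
move=> [xr _] /eqP xT /eqP xU.
have := rIU T U; rewrite -(ler_nat R) !natrD -xT -xU -(sum_setUI x T U) => le.
have := xr (T :&: U); have := xr (T :|: U); rewrite /tight !eq_le => le1 le2.
by rewrite le1 le2 /=; apply/andP; split; lra.
Qed.

Lemma tight0 x : tight x set0.
Proof. by rewrite /tight big_set0 r0. Qed.

Lemma tightT x : in_base x -> tight x [set: A].
Proof. by move=> [_ /eqP]; rewrite /tight big_setT. Qed.

Lemma tight_bigcap x (I : finType) (P : pred I) (T : I -> {set A}) :
  in_base x -> (forall i, P i -> tight x (T i)) -> tight x (\bigcap_(i | P i) T i).
Proof.
move=> xB Tt; elim/big_ind: _ => [|U W Ut Wt|]; [exact: tightT| |exact: Tt].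
by case/andP: (tightIU xB Ut Wt).
Qed.

Lemma tight_bigcup x (I : finType) (P : pred I) (T : I -> {set A}) :
  in_base x -> (forall i, P i -> tight x (T i)) -> tight x (\bigcup_(i | P i) T i).
Proof.
move=> xB Tt; elim/big_ind: _ => [|U W Ut Wt|]; [exact: tight0| |exact: Tt].
by case/andP: (tightIU xB Ut Wt).
Qed.

Lemma in_base_ge0 x e : in_base x -> 0 <= x e.
Proof.
move=> [xr xA]; have := xr [set~ e].
have -> : \sum_(f in [set~ e]) x f = (r [set: A])%:R - x e.
  rewrite -xA [in RHS](bigD1 e) //= [RHS]addrC addKr; apply: eq_bigl => f.
  by rewrite !inE.
have : (r [set~ e])%:R <= (r [set: A])%:R :> R by rewrite ler_nat rS // subsetT.
lra.
Qed.

Lemma in_base_le1 x e : in_base x -> x e <= 1.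
Proof.
move=> [/(_ [set e])]; rewrite big_set1 => /le_trans le _; apply: le.
by rewrite lern1 r1.
Qed.

Definition tight_class x e : {set {set A}} := [set T | tight x T & e \in T].

(** The class of [e] is [D :\: U], with [D] the least tight set containing [e] and [U] the union of
    the tight subsets of [D] avoiding [e]. Both are tight by uncrossing, so the sum is a difference
    of two ranks. *)
Lemma tight_class_sum x e : in_base x ->
  \sum_(f | tight_class x f == tight_class x e) x f \is a Num.int.
Proof.
move=> xB; pose D := \bigcap_(T | tight x T && (e \in T)) T.
pose U := \bigcup_(T | [&& tight x T, T \subset D & e \notin T]) T.
have Dt : tight x D by apply: tight_bigcap => // T /andP[].
have Ut : tight x U by apply: tight_bigcup => // T /and3P[].
have UD : U \subset D by apply/bigcupsP => T /and3P[].
have eD : e \in D by apply/bigcapP => T /andP[].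
have clsE f : (tight_class x f == tight_class x e) = (f \in D :\: U).
  rewrite inE; apply/eqP/andP => [fe|[fU fD]].
    have sameT T : tight x T -> (f \in T) = (e \in T).
      by move=> Tt; have /setP/(_ T) := fe; rewrite !inE Tt.
    split; last by rewrite sameT.
    by rewrite sameT //; apply/bigcupP => -[T /and3P[_ _ /negP]].
  apply/setP => T; rewrite !inE; case Tt: (tight x T) => //=.
  apply/idP/idP => [fT|eT]; last first.
    by move/bigcapP: fD; apply; rewrite Tt.
  apply: contraNT fU => eT; apply/bigcupP; exists (T :&: D); rewrite ?inE ?fT //.
  have /andP[-> _] := tightIU xB Tt Dt.
  by rewrite subsetIr (negbTE eT).
have -> : \sum_(f | tight_class x f == tight_class x e) x f = (r D)%:R - (r U)%:R.
  rewrite (eq_bigl _ _ clsE) -(eqP Dt) -(eqP Ut) (@big_setID _ _ _ _ D U) /=.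
  by rewrite (setIidPr UD) addrC addrK.
by rewrite rpredB ?rpred_nat.
Qed.

Lemma fractional_fiber x (X : eqType) (a : A -> X) (i : X) :
    \sum_(e | a e == i) x e \is a Num.int ->
  #|[set e in [set e | x e \isn't a Num.int] | a e == i]| != 1%N.
Proof.
pose Fr := [set e | x e \isn't a Num.int]; rewrite -/Fr.
move=> xi; apply/negP => /cards1P[e eE].
have : e \in [set e in Fr | a e == i] by rewrite eE set11.
rewrite !inE => /andP[/negP xe aei]; apply: xe.
move: xi; rewrite (bigD1 e) //= rpredDr // rpred_sum // => f /andP[af fe].
apply/negPn/negP => xf; have : f \in [set e in Fr | a e == i] by rewrite !inE xf.
by rewrite eE inE (negbTE fe).
Qed.

Lemma card_fibers (X : finType) (a : A -> X) (D : {set A}) :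
  #|D| = (\sum_(i in a @: D) #|[set e in D | a e == i]|)%N.
Proof.
rewrite -sum1_card (partition_big_imset a) /=; apply: eq_bigr => i _.
by rewrite -sum1_card; apply: eq_bigl => e; rewrite inE.
Qed.

(* The fractional arcs fall into tight classes and stars of saturated heads,
   each containing none or at least two of them, so that there are at most as
   many balance conditions as fractional arcs; when the numbers agree, every
   head is saturated and the conditions are linearly dependent. *)
Lemma vertex_integral x :
    in_base x -> (forall v, \sum_(e in star v) x e <= k%:R) ->
    (forall y, (forall T, tight x T -> \sum_(e in T) y e = 0) ->
       (forall v, \sum_(e in star v) x e = k%:R -> \sum_(e in star v) y e = 0) -> y = 0) ->
  exists F, x = [ffun e => (e \in F)%:R].
Proof.
move=> xB xk xvert; pose Fr := [set e | x e \isn't a Num.int].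
pose cl := tight_class x; pose full v := \sum_(e in star v) x e == k%:R.
pose fc i := [set e in Fr | cl e == i]; pose fh v := [set e in Fr | hd e == v].
have fc2 i : i \in cl @: Fr -> (2 <= #|fc i|)%N.
  move=> /imsetP[e eFr ->]; have := fractional_fiber (tight_class_sum e xB).
  rewrite -/Fr -/(fc (cl e)); have : (0 < #|fc (cl e)|)%N.
    by apply/card_gt0P; exists e; rewrite inE eFr eqxx.
  by case: #|fc _| => [|[|]].
have fh2 v : v \in hd @: Fr -> full v -> (2 <= #|fh v|)%N.
  move=> /imsetP[e eFr ->] /eqP fullv; have := @fractional_fiber x _ hd (hd e).
  rewrite -/Fr -/(fh (hd e)); have : (0 < #|fh (hd e)|)%N.
    by apply/card_gt0P; exists e; rewrite inE eFr eqxx.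
  have -> : \sum_(f | hd f == hd e) x f = k%:R.
    by rewrite -fullv; apply: eq_bigl => f; rewrite inE.
  by rewrite rpred_nat; case: #|fh _| => [|[|]] // _ /(_ isT).
have Fr0 : Fr = set0.
  apply/eqP; apply: contraT => /set0Pn[e0 e0Fr].
  pose I := cl @: Fr; pose H := hd @: Fr.
  have I2 : (2 * #|I| <= #|Fr|)%N.
    rewrite (card_fibers cl) mulnC -sum_nat_const; exact: leq_sum.
  (* Every tight set meets [Fr] in whole classes, so such a [y] preserves all tight constraints and
     contradicts the vertex property. *)
  suff [y [[e ye] yFr ycl yhd]] : exists y : {ffun A -> R}, [/\ exists e, y e != 0,
      forall e, e \notin Fr -> y e = 0, forall i, i \in I -> \sum_(e in fc i) y e = 0
    & forall v, v \in H -> full v -> \sum_(e in fh v) y e = 0].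
    case/eqP: ye; suff -> : y = 0 by rewrite ffunE.
    have restr T : \sum_(e in T) y e = \sum_(e in T :&: Fr) y e.
      rewrite (@big_setID _ _ _ _ T Fr) /= [X in _ + X]big1 ?addr0 // => f.
      by rewrite inE => /andP[/yFr].
    apply: xvert => [T Tt|v /eqP fullv].
      rewrite restr (partition_big_imset cl) big1 // => i /imsetP[f].
      rewrite inE => /andP[fT fFr] ->; rewrite -[RHS](ycl (cl f)) ?imset_f //.
      apply: eq_bigl => g; rewrite !inE andbC; case: eqP => [gf|]; rewrite ?andbF //=.
      have /setP/(_ T) := gf; rewrite !inE Tt fT /= => ->.
      by rewrite andbT.
    rewrite restr; have -> : star v :&: Fr = fh v by apply/setP => f; rewrite !inE andbC.
    have [vH|vH] := boolP (v \in H); first exact: yhd.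
    by rewrite big1 // => f; rewrite inE => /andP[fFr /eqP fv]; rewrite -fv imset_f in vH.
  have [/forall_inP allfull|/forall_inPn[v1 v1H v1full]] := boolP [forall v in H, full v].
    have H2 : (2 * #|H| <= #|Fr|)%N.
      rewrite (card_fibers hd) mulnC -sum_nat_const; apply: leq_sum => v vH.
      by rewrite fh2 ?allfull.
    pose i0 := cl e0; have i0I : i0 \in I by rewrite imset_f.
    pose cs := [seq fc i | i <- enum (I :\ i0)] ++ [seq fh v | v <- enum H].
    have [|y [y0 yFr ycs]] := @few_constraints R _ Fr cs.
      by rewrite size_cat !size_map -!cardE; have := cardsD1 i0 I; rewrite i0I; lia.
    have ycl i : i \in I -> i != i0 -> \sum_(e in fc i) y e = 0.
      move=> iI ii0; apply: ycs; rewrite mem_cat map_f //.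
      by rewrite mem_enum !inE ii0.
    have yhd v : v \in H -> \sum_(e in fh v) y e = 0.
      by move=> vH; apply: ycs; rewrite mem_cat orbC map_f // mem_enum.
    exists y; split=> // [i iI|v vH _]; last exact: yhd.
    have [->|] := eqVneq i i0; last exact: ycl.
    have : \sum_(e in Fr) y e = 0.
      rewrite (partition_big_imset hd) big1 // => v vH; apply: etrans (yhd v vH).
      by apply: eq_bigl => f; rewrite [RHS]inE.
    rewrite (partition_big_imset cl) (bigD1 i0) //= [X in _ + X]big1 => [|j /andP[jI ji]].
      rewrite addr0 => fc0; apply: etrans fc0.
      by apply: eq_bigl => f; rewrite [LHS]inE.
    by apply: etrans (ycl j jI ji); apply: eq_bigl => f; rewrite [RHS]inE.
  pose Hf := [set v in H | full v].
  (* The unsaturated head [v1] is entered by a fractional arc that no saturated star counts, hence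
     the strict inequality. *)
  have Hf2 : (2 * #|Hf| < #|Fr|)%N.
    rewrite (card_fibers hd) (bigD1 v1) //= mulnC -sum_nat_const -add1n leq_add //.
      by have /imsetP[e eFr ->] := v1H; apply/card_gt0P; exists e; rewrite inE eFr eqxx.
    rewrite [X in (_ <= X)%N](bigID (mem Hf)) /= -[X in (X <= _)%N]addn0 leq_add //.
    rewrite [X in (_ <= X)%N](eq_bigl (mem Hf)) => [|v].
      by apply: leq_sum => v; rewrite inE => /andP[]; exact: fh2.
    rewrite !inE; have [->|_] := eqVneq v v1; first by rewrite (negbTE v1full) !andbF.
    by rewrite andbT andbA andbb.
  pose cs := [seq fc i | i <- enum I] ++ [seq fh v | v <- enum Hf].
  have [|y [y0 yFr ycs]] := @few_constraints R _ Fr cs.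
    by rewrite size_cat !size_map -!cardE; lia.
  exists y; split=> // [i iI|v vH vf]; apply: ycs; rewrite mem_cat map_f ?mem_enum //.
    by rewrite orbT.
  by rewrite inE vH.
exists [set e | x e == 1]; apply/ffunP => e; rewrite ffunE inE.
have /intrP[m xm] : x e \is a Num.int.
  by apply/negPn/negP => xe; have := in_set0 e; rewrite -Fr0 inE xe.
have := in_base_ge0 e xB; have := in_base_le1 e xB; rewrite {}xm ler0z -[1]/(1%:~R) ler_int.
rewrite eqr_int; case: m => [[|[|m]]|m] //=.
Qed.

End BasePolytope.

(** * Shortest walks and potentials *)

Section Walks.
Variables (V E : finType) (src dst : E -> V) (good : pred E).

Fixpoint walk (v : V) (s : seq E) : bool :=
  if s is e :: s' then [&& good e, src e == v & walk (dst e) s'] else true.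

Definition walk_end (v : V) (s : seq E) : V := last v (map dst s).

Lemma walk_cat v s1 s2 : walk v (s1 ++ s2) = walk v s1 && walk (walk_end v s1) s2.
Proof. by elim: s1 v => //= e s1 IHs v; rewrite IHs !andbA. Qed.

Lemma walk_end_cat v s1 s2 : walk_end v (s1 ++ s2) = walk_end (walk_end v s1) s2.
Proof. by rewrite /walk_end map_cat last_cat. Qed.

Lemma walk_good v s e : walk v s -> e \in s -> good e.
Proof.
elim: s v => //= e' s IHs v /and3P[ge' _ ws]; rewrite inE => /orP[/eqP->//|].
exact: IHs ws.
Qed.

Lemma walk_telescope (M : zmodType) (phi : V -> M) v s :
  walk v s -> \sum_(e <- s) (phi (dst e) - phi (src e)) = phi (walk_end v s) - phi v.
Proof.
elim: s v => [|e s IHs] v; first by rewrite big_nil subrr.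
by rewrite big_cons /= => /and3P[_ /eqP-> /IHs->]; rewrite addrC subrKA.
Qed.

Variables (R : realFieldType) (len : E -> R).
Hypothesis no_negative_cycle : forall v s,
  walk v s -> walk_end v s = v -> 0 <= \sum_(e <- s) len e.

(** A walk of more than [#|V|] edges repeats a vertex, and cutting out the closed walk in between
    does not increase the length. *)
Lemma short_walk v s : walk v s ->
  exists s', [/\ walk v s', walk_end v s' = walk_end v s, (size s' <= #|V|)%N
    & \sum_(e <- s') len e <= \sum_(e <- s) len e].
Proof.
have [n] := ubnP (size s); elim: n s => // n IHn s; rewrite ltnS => les ws.
have [small|large] := leqP (size s) #|V|; first by exists s.
have : ~~ uniq (v :: map dst s).
  apply: contraL large => /card_uniqP; rewrite -leqNgt /= size_map => sE.
  by apply: ltnW; rewrite -sE max_card.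
move=> /(uniqPn v)[i [j [ij]]]; rewrite /= size_map ltnS => js nthij.
have endE m : walk_end v (take m s) = nth v (v :: map dst s) (minn m (size s)).
  rewrite /walk_end map_take (last_nth v) size_take size_map.
  rewrite /minn; case: ltnP => ms; first by rewrite -[v :: _]/(take m.+1 (v :: _)) nth_take.
  by rewrite take_oversize // size_map.
have sE : s = take i s ++ drop i (take j s) ++ drop j s.
  by rewrite catA -[X in X ++ drop i _](@take_takel _ i j) ?(ltnW ij) // !cat_take_drop.
have ei := endE i; rewrite (minn_idPl (leq_trans (ltnW ij) js)) in ei.
have ej := endE j; rewrite (minn_idPl js) -nthij -ei in ej.
have tjE : take j s = take i s ++ drop i (take j s).
  by rewrite -{1}(@take_takel _ i j) ?(ltnW ij) // cat_take_drop.
rewrite {1}tjE walk_end_cat in ej.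
have := ws; rewrite sE !walk_cat => /and3P[w1 w2 w3]; rewrite ej in w3.
have [||s' [ws' es' ss' ls']] := IHn (take i s ++ drop j s).
- rewrite size_cat size_take size_drop (leq_trans ij js).
  by apply: leq_trans les; lia.
- by rewrite walk_cat w1.
exists s'; split=> //; first by rewrite es' !walk_end_cat ej.
apply: le_trans ls' _; rewrite !big_cat /= lerD2l lerDr.
exact: no_negative_cycle w2 ej.
Qed.

(** [p v] is the least length plus terminal cost [tau] of a walk from [v]. By [short_walk] only
    walks of bounded size compete; they form a finite type, so the minimum is attained. *)
Lemma walk_potential (tau : V -> R) :
  exists p : V -> R, [/\ forall v, p v <= tau v,
    forall e, good e -> p (src e) <= len e + p (dst e)
  & forall v, exists s, [/\ walk v s, (size s <= #|V|)%N
      & p v = \sum_(e <- s) len e + tau (walk_end v s)]].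
Proof.
pose value v s := \sum_(e <- s) len e + tau (walk_end v s).
have /choice[best bestP] v : exists s, [/\ walk v s, (size s <= #|V|)%N
    & forall s', walk v s' -> value v s <= value v s'].
  case: (@arg_minP _ _ _ [bseq] (fun s : #|V|.-bseq E => walk v s) (value v)) => // s ws smin.
  exists s; split=> //; first exact: size_bseq.
  move=> s' /short_walk[s'' [ws'' es'' ss'' ls'']].
  apply: (le_trans (smin (Bseq ss'') ws'')).
  by rewrite /value /= es'' lerD2r.
exists (fun v => value v (best v)); split=> [v|e ge|v].
- have [_ _ /(_ [::] isT)] := bestP v.
  by rewrite /value big_nil add0r.
- have [w _ _] := bestP (dst e); have [_ _ /(_ (e :: best (dst e)))] := bestP (src e).
  by rewrite /= ge eqxx w /value big_cons addrA => /(_ isT).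
- by have [w sz _] := bestP v; exists (best v).
Qed.

End Walks.

(* Summation by parts over the level sets of g. *)
Lemma sum_level_sets (R : realFieldType) (A : finType) (g z : A -> R) :
  \sum_e z e = 0 -> (forall t, \sum_(e | g e <= t) z e <= 0) ->
  0 <= \sum_e g e * z e.
Proof.
move=> z0; case: (pickP (@predT A)) => [a0 _|A0]; last by rewrite big_pred0.
have [a _ aM] : exists2 a, a \in A & forall e, g e <= g a.
  by case: (@arg_maxP _ _ _ a0 predT g) => // a _ aM; exists a => // e; apply: aM.
have [n] := ubnP #|[pred e | g e != g a]|; elim: n g a aM => // n IHn g a aM.
rewrite ltnS => lean glev.
case: (pickP [pred e | g e != g a]) => [b0 b0a|all_a]; last first.
  rewrite (eq_bigr (fun e => g a * z e)) ?[X in 0 <= X](_ : _ = 0) //.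
    by rewrite -mulr_sumr z0 mulr0.
  by move=> e _; have /negbFE/eqP-> := all_a e.
case: (@arg_maxP _ _ _ b0 (fun e => g e != g a) g b0a) => b ba bM.
have lt_ba : g b < g a by rewrite lt_neqAle ba aM.
(* The top level of [g] is merged into the next one. The top level has nonnegative [z]-sum because
   its complement is a sublevel set. *)
pose g' e := if g e == g a then g b else g e.
have g'b : g' b = g b by rewrite /g' (negbTE ba).
have g'M e : g' e <= g' b.
  by rewrite g'b /g'; case: ifPn => // /bM.
have upper : 0 <= \sum_(e | g e == g a) z e.
  move: z0; rewrite (bigID (fun e => g e == g a)) /= => /eqP.
  rewrite addr_eq0 => /eqP ->; rewrite oppr_ge0.
  rewrite [leLHS](eq_bigl (fun e => g e <= g b)) // => e.
  by apply/idP/idP => [/bM//|eb]; rewrite lt_eqF // (le_lt_trans eb).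
have -> : \sum_e g e * z e = \sum_e g' e * z e + (g a - g b) * \sum_(e | g e == g a) z e.
  rewrite mulr_sumr [in X in _ + X]big_mkcond -big_split /=; apply: eq_bigr => e _.
  by rewrite /g'; case: eqP => [->|_]; rewrite ?addr0 // -mulrDl addrC subrK.
rewrite addr_ge0 //; last by rewrite mulr_ge0 // subr_ge0 ltW.
apply: (IHn g' b) => // [|t].
  apply: leq_trans lean; apply: proper_card; apply/properP; split.
    apply/subsetP => e; rewrite !inE /=; apply: contra => /eqP ea.
    by rewrite g'b /g' ea eqxx.
  by exists b; rewrite !inE ?eqxx.
have [bt|tb] := leP (g b) t.
  rewrite [leLHS](eq_bigl predT) ?z0 // => e.
  by rewrite (le_trans (g'M e)) // g'b.
rewrite [leLHS](eq_bigl (fun e => g e <= t)) // => e.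
by rewrite /g'; case: eqP => [->|//]; rewrite !leNgt tb (lt_trans tb).
Qed.

Lemma uniform_gap (R : realFieldType) (I : finType) (phi : I -> R) :
  exists2 d, 0 < d & forall i, 0 < phi i -> d <= phi i.
Proof.
case: (pickP (fun i => 0 < phi i)) => [i0 i0P|none].
  case: (@arg_minP _ _ _ i0 (fun i => 0 < phi i) phi i0P) => i iP imin.
  by exists (phi i).
by exists 1 => // i; rewrite none.
Qed.

(** * Optimal solutions minimizing the degrees along a chain *)

Lemma sub_walk (V E : finType) (src dst : E -> V) (P Q : pred E) v s :
  subpred P Q -> walk src dst P v s -> walk src dst Q v s.
Proof. by move=> PQ; elim: s v => //= e s IHs v /and3P[/PQ-> -> /IHs->]. Qed.

Section Exchanges.
Variables (R : realType) (A V : finType) (hd : A -> V) (k : nat) (r : {set A} -> nat).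
Hypothesis r0 : r set0 = 0%N.
Hypothesis r1 : forall e, (r [set e] <= 1)%N.
Hypothesis rS : forall T U : {set A}, T \subset U -> (r T <= r U)%N.
Hypothesis rIU : forall T U : {set A}, (r (T :&: U) + r (T :|: U) <= r T + r U)%N.

Implicit Types (x y : {ffun A -> R}) (T U F : {set A}) (s : seq (A * A)).

(** Lowering [x] slightly at the first arc and raising it equally at the second respects every tight
    rank constraint. *)
Definition exchangeable x (ef : A * A) : bool :=
  [forall T : {set A}, tight r x T ==> (ef.2 \in T) ==> (ef.1 \in T)].

Lemma exchangeableP x ef T : exchangeable x ef -> tight r x T -> ef.2 \in T -> ef.1 \in T.
Proof. by move=> /forallP/(_ T) /implyP xT /xT /implyP. Qed.

(** With each [f], a sublevel set of [g] contains the least tight set around [f]. It is thus a union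
    of tight sets, hence tight, and [x'] cannot have a larger sum there; summation by parts
    concludes. *)
Lemma base_local_opt x x' (g : A -> R) : in_base r x -> in_base r x' ->
    (forall ef, exchangeable x ef -> g ef.1 <= g ef.2) ->
  \sum_e g e * x e <= \sum_e g e * x' e.
Proof.
move=> xB x'B loc; rewrite -subr_ge0 -sumrB.
under eq_bigr do rewrite -mulrBr.
apply: sum_level_sets => [|t]; first by rewrite sumrB (proj2 xB) (proj2 x'B) subrr.
rewrite sumrB subr_le0; pose L := [set e | g e <= t].
have sumL z : \sum_(e | g e <= t) z e = \sum_(e in L) z e :> R.
  by apply: eq_bigl => e; rewrite inE.
rewrite !sumL; suff /eqP-> : tight r x L by exact: (proj1 x'B).
pose TT f := \bigcap_(T | tight r x T && (f \in T)) T.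
have TTt f : tight r x (TT f) by apply: (tight_bigcap rIU xB) => T /andP[].
have -> : L = \bigcup_(f in L) TT f; last by apply: (tight_bigcup r0 rIU xB).
apply/eqP; rewrite eqEsubset; apply/andP; split.
  apply/subsetP => f fL; apply/bigcupP; exists f => //.
  by apply/bigcapP => T /andP[].
apply/bigcupsP => f fL; apply/subsetP => e /bigcapP eTT; rewrite inE.
rewrite inE in fL; apply: le_trans fL; apply: (loc (e, f)).
by apply/forallP => T; apply/implyP => Tt; apply/implyP => fT; apply: eTT; rewrite Tt.
Qed.

Definition shift s : {ffun A -> R} :=
  [ffun a => \sum_(ef <- s) ((a == ef.2)%:R - (a == ef.1)%:R)].

Lemma shift_in T s :
  \sum_(a in T) shift s a = \sum_(ef <- s) ((ef.2 \in T)%:R - (ef.1 \in T)%:R).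
Proof.
rewrite [LHS](eq_bigr _ (fun a _ => ffunE _ a)) exchange_big /=.
by apply: eq_bigr => ef _; rewrite sumrB !sum_indicator.
Qed.

Lemma shift_weight (g : A -> R) s :
  \sum_a g a * shift s a = \sum_(ef <- s) (g ef.2 - g ef.1).
Proof.
have pick (b : A) : \sum_a g a * (a == b)%:R = g b.
  by rewrite (bigD1 b) //= eqxx mulr1 big1 ?addr0 // => a /negbTE->; rewrite mulr0.
under eq_bigr do rewrite ffunE mulr_sumr.
rewrite exchange_big /=; apply: eq_bigr => ef _.
by under eq_bigr do rewrite mulrBr; rewrite sumrB !pick.
Qed.

Definition indicator F : {ffun A -> R} := [ffun e => (e \in F)%:R].

Lemma indicator_in F T : \sum_(e in T) indicator F e = #|F :&: T|%:R.
Proof.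
rewrite -sum1_card natr_sum (eq_bigr _ (fun a _ => ffunE _ a)) [LHS]big_mkcond [RHS]big_mkcond /=.
by apply: eq_bigr => e _; rewrite inE andbC; case: (e \in T); case: (e \in F).
Qed.

Lemma indicator_weight (c : A -> R) F : \sum_e c e * indicator F e = \sum_(e in F) c e.
Proof.
rewrite [RHS]big_mkcond; apply: eq_bigr => e _; rewrite ffunE.
by case: (e \in F); rewrite ?mulr1 ?mulr0.
Qed.

Lemma indicator_head_weight (phi : V -> R) F :
  \sum_e phi (hd e) * indicator F e = \sum_v phi v * #|F :&: star hd v|%:R.
Proof.
rewrite (partition_big hd predT) //=; apply: eq_bigr => v _.
rewrite -indicator_in mulr_sumr; apply: eq_big => [e|e /eqP<- //].
by rewrite inE.
Qed.

Definition feasible F : Prop :=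
  [/\ forall T, (#|F :&: T| <= r T)%N, #|F| = r [set: A]
    & forall v, (#|F :&: star hd v| <= k)%N].

Lemma feasible_in_base F : feasible F -> in_base r (indicator F).
Proof.
move=> [Fr FA _]; split=> [T|]; first by rewrite indicator_in ler_nat.
by rewrite -big_setT indicator_in setIT FA.
Qed.

Section Optimum.
Variables (c : A -> R) (omega : V -> R) (F : {set A}).
Hypothesis F_feasible : feasible F.
Hypothesis F_opt : forall F', feasible F' ->
  \sum_(e in F) c e <= \sum_(e in F') c e /\
  (\sum_(e in F') c e = \sum_(e in F) c e ->
   \sum_(e in F) omega (hd e) <= \sum_(e in F') omega (hd e)).

Let full v := #|F :&: star hd v| == k.

(** Lexicographic optimality of [F] is stable under convex combinations and the vertices are
    indicators of feasible sets, so it holds on the whole polytope. The hypotheses say that [y]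
    points into that polytope from [indicator F]. *)
Lemma optimum_direction y :
    (forall T, tight r (indicator F) T -> \sum_(e in T) y e <= 0) -> \sum_e y e = 0 ->
    (forall v, full v -> \sum_(e in star hd v) y e <= 0) ->
  0 <= \sum_e c e * y e /\ (\sum_e c e * y e = 0 -> 0 <= \sum_e omega (hd e) * y e).
Proof.
move=> yT yA yv.
pose l (j : option ({set A} + V)) (x : {ffun A -> R^o}) : R :=
  match j with
  | Some (inl T) => \sum_(e in T) x e
  | Some (inr v) => \sum_(e in star hd v) x e
  | None => - \sum_e x e
  end.
pose b (j : option ({set A} + V)) : R :=
  match j with
  | Some (inl T) => (r T)%:R
  | Some (inr v) => k%:R
  | None => - (r [set: A])%:R
  end.
have lin (P : pred A) (g : A -> R) (x z : {ffun A -> R^o}) t :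
    \sum_(e | P e) g e * (x + t *: z) e =
    \sum_(e | P e) g e * x e + t * \sum_(e | P e) g e * z e.
  rewrite mulr_sumr -big_split /=; apply: eq_bigr => e _.
  by rewrite !ffunE mulrDr mulrCA.
have lin1 (P : pred A) (x z : {ffun A -> R^o}) t :
    \sum_(e | P e) (x + t *: z) e = \sum_(e | P e) x e + t * \sum_(e | P e) z e.
  by rewrite mulr_sumr -big_split /=; apply: eq_bigr => e _; rewrite !ffunE.
have linl j (x z : {ffun A -> R^o}) t : l j (x + t *: z) = l j x + t * l j z.
  by case: j => [[T|v]|] /=; rewrite lin1 // mulrN -opprD.
have lbnd (z : {ffun A -> R^o}) : (forall j, l j z <= 0) -> z = 0.
  move=> zneg; have zv v : z v <= 0.
    by have := zneg (Some (inl [set v])); rewrite /= big_set1.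
  have := zneg None; rewrite /= lerNl oppr0 => zA.
  apply/ffunP => v; rewrite ffunE; apply/eqP; rewrite eq_le zv /=.
  by move: zA; rewrite (bigD1 v) //= => /le_trans -> //; rewrite gerDl sumr_le0.
pose C (x : {ffun A -> R^o}) : Prop := \sum_(e in F) c e <= \sum_e c e * x e /\
  (\sum_e c e * x e = \sum_(e in F) c e ->
   \sum_(e in F) omega (hd e) <= \sum_e omega (hd e) * x e).
have CP : forall x : {ffun A -> R^o}, (forall j, l j x <= b j) -> C x.
  apply: (polyhedron_ind linl lbnd) => [x z t t0 t1 [cx ox] [cz oz]|x xP xvert].
    have comb (g : A -> R) : \sum_e g e * (t *: x + (1 - t) *: z) e =
        t * (\sum_e g e * x e) + (1 - t) * (\sum_e g e * z e).
      rewrite !lin; congr (_ + _); rewrite mulr_sumr; apply: eq_bigr => e _.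
      by rewrite !ffunE mulrCA.
    rewrite /C !comb; move: cx ox cz oz; set m := \sum_(e in F) c e.
    set cx := \sum_e c e * x e; set cz := \sum_e c e * z e => mx ox mz oz.
    split=> [|eqm]; first nra.
    have xm : cx = m by nra.
    have zm : cz = m by nra.
    have := ox xm; have := oz zm; nra.
  have xB : in_base r x.
    split=> [T|]; first exact: xP (Some (inl T)).
    apply/eqP; rewrite eq_le -[X in _ && X]lerN2 (xP None) andbT -big_setT.
    exact: xP (Some (inl [set: A])).
  have xk v : \sum_(e in star hd v) x e <= k%:R := xP (Some (inr v)).
  have [|F' xE] := vertex_integral r0 r1 rS rIU xB xk.
    move=> z zT zv; apply: xvert => -[[T|v]|] /=; rewrite /b /=.
    - by move=> xT; apply: zT; apply/eqP.
    - exact: zv.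
    - by move=> _; rewrite -big_setT zT ?oppr0 // tightT.
  have indF : x = indicator F' by [].
  have feasF' : feasible F'.
    split=> [T||v].
    - by rewrite -(ler_nat R) -indicator_in -indF; exact: (proj1 xB).
    - by apply/eqP; rewrite -(eqr_nat R) -(proj2 xB) indF -big_setT indicator_in setIT.
    - by rewrite -(ler_nat R) -indicator_in -indF.
  by rewrite /C indF !indicator_weight; exact: F_opt.
have [FB [_ _ Fk]] := (feasible_in_base F_feasible, F_feasible).
have FP j : l j (indicator F) <= b j.
  case: j => [[T|v]|] /=; first exact: (proj1 FB).
    by rewrite indicator_in ler_nat.
  by rewrite (proj2 FB).
have [|t [t0 tP _]] := feasible_step linl (x := indicator F : {ffun A -> R^o}) FP (y := y).
  case=> [[T|v]|] /=; rewrite /b /=.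
  - by move=> FT; apply: yT; apply/eqP.
  - by move=> /eqP; rewrite indicator_in eqr_nat; exact: yv.
  - by rewrite yA oppr0.
have := CP _ tP; rewrite /C !lin !indicator_weight lerDl pmulr_rge0 // lerDl pmulr_rge0 //.
by move=> [cy oy]; split=> // cy0; apply: oy; rewrite cy0 mulr0 addr0.
Qed.

Let src (ef : A * A) := hd ef.1.
Let dst (ef : A * A) := hd ef.2.
Let good := exchangeable (indicator F).
Let len (ef : A * A) := c ef.2 - c ef.1.

(** The exchanges of the walk add up to a direction whose degrees telescope: only the start loses a
    unit and only the end gains one. This is admissible if the walk is closed or its end is
    unsaturated. *)
Lemma optimum_walk v s : walk src dst good v s ->
    walk_end dst v s = v \/ ~~ full (walk_end dst v s) ->
  0 <= \sum_(ef <- s) len ef /\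
  (\sum_(ef <- s) len ef = 0 -> omega v <= omega (walk_end dst v s)).
Proof.
move=> ws v_end.
have -> : \sum_(ef <- s) len ef = \sum_e c e * shift s e by rewrite shift_weight.
have <- : (0 <= \sum_e omega (hd e) * shift s e) = (omega v <= omega (walk_end dst v s)).
  by rewrite (shift_weight (omega \o hd)) -(subr_ge0 (omega v)) -(walk_telescope omega ws).
apply: optimum_direction => [T Tt||u uF].
- rewrite shift_in big_seq; apply: sumr_le0 => ef /(walk_good ws) gef.
  have := exchangeableP gef Tt; case: (ef.2 \in T) => [->|_] //; first by rewrite subrr.
  by rewrite sub0r oppr_le0.
- by rewrite -big_setT shift_in big1 // => ef _; rewrite !inE subrr.
- rewrite shift_in; under eq_bigr do rewrite !inE.
  rewrite (walk_telescope (fun v => (v == u)%:R) ws) subr_le0.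
  case: v_end => [->//|]; case: eqP => [->|_ _]; first by rewrite uF.
  exact: ler0n.
Qed.

(** Walk potentials with terminal cost 0 at unsaturated vertices. Optimality of [F] makes closed
    walks, and walks ending at an unsaturated vertex, nonnegative. *)
Lemma weight_splitting : exists p : V -> R, [/\ forall v, 0 <= p v,
    forall v, p v != 0 -> full v
  & forall ef, good ef -> c ef.1 + p (hd ef.1) <= c ef.2 + p (hd ef.2)].
Proof.
(* Large enough to outweigh any walk of at most [#|V|] exchanges, so [p] stays nonnegative when the
   best walk ends at a saturated vertex. *)
pose M := #|V|%:R * \sum_ef `|len ef|.
have [v s ws vs|p [ptau plen pwalk]] :=
    @walk_potential _ _ src dst good R len _ (fun v => if full v then M else 0).
  by have [] := optimum_walk ws (or_introl vs).
have p0 v : 0 <= p v.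
  have [s [ws sz ->]] := pwalk v; case: ifPn => [_|nfull]; last first.
    by rewrite addr0; have [] := optimum_walk ws (or_intror nfull).
  rewrite -lerBlDr sub0r lerNl -sumrN; apply: (@le_trans _ _ (\sum_(ef <- s) \sum_ef `|len ef|)).
    apply: ler_sum => ef _; rewrite (bigD1 ef) //= -normrN.
    by rewrite (le_trans (ler_norm _)) // lerDl sumr_ge0.
  rewrite big_const_seq count_predT iter_addr_0 -mulr_natl ler_wpM2r ?ler_nat //.
  exact: sumr_ge0.
exists p; split=> // [v|ef gef].
  apply: contraNT => nfull; have := ptau v; rewrite (negbTE nfull) => pv.
  by rewrite eq_le pv p0.
by have := plen _ gef; rewrite /len /src /dst; lra.
Qed.

(** With this [omega], the secondary objective is the sum of the in-degrees of the chain members.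
    The comparison on [Z] reduces to one on [W]: on [Z :\: W] both degrees are [k], and on [W :\: Z]
    that of [F] is [k]. *)
Lemma optimum_chain (CC : {set {set V}}) :
    set_chain CC -> (forall v, omega v = #|[set Z in CC | v \in Z]|%:R) ->
    forall F', feasible F' -> \sum_(e in F') c e = \sum_(e in F) c e ->
    forall Z, Z \in CC ->
  (\sum_(v in Z) #|F :&: star hd v| <= \sum_(v in Z) #|F' :&: star hd v|)%N.
Proof.
move=> chainC omegaE F' feasF' cF' Z ZC.
have [p [p0 pfull pgood]] := weight_splitting.
pose h v : R := #|F :&: star hd v|%:R; pose h' v : R := #|F' :&: star hd v|%:R.
have [[_ _ Fk] [_ _ F'k]] := (F_feasible, feasF').
have hk v : h v <= k%:R by rewrite ler_nat.
have h'k v : h' v <= k%:R by rewrite ler_nat.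
have hfull v : p v != 0 -> h v = k%:R by move=> /pfull /eqP; rewrite /h => ->.
have FB := feasible_in_base F_feasible; have F'B := feasible_in_base feasF'.
pose cp e := c e + p (hd e).
have split_weight (phi : V -> R) G :
    \sum_e (c e + phi (hd e)) * indicator G e =
    \sum_(e in G) c e + \sum_v phi v * #|G :&: star hd v|%:R.
  rewrite -indicator_weight -indicator_head_weight -big_split /=.
  by apply: eq_bigr => e _; rewrite mulrDl.
have term v : 0 <= p v * (h v - h' v).
  have [->|/hfull->] := eqVneq (p v) 0; first by rewrite mul0r.
  by rewrite mulr_ge0 ?subr_ge0.
(* Complementary slackness: [F'] has equal cost and no smaller [cp]-weight than [F], so all the
   nonnegative terms vanish. *)
have h'full v : p v != 0 -> h' v = k%:R.
  have := @base_local_opt _ _ cp FB F'B pgood; rewrite !(split_weight p) cF' lerD2l => pF.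
  have sum0 : \sum_v p v * (h v - h' v) = 0.
    apply/eqP; rewrite eq_le sumr_ge0 // andbT.
    by under eq_bigr do rewrite mulrBr; rewrite sumrB subr_le0.
  move=> pv; have /eqP : p v * (h v - h' v) = 0 by apply: (psumr_eq0P (fun v _ => term v) sum0).
  by rewrite mulf_eq0 (negbTE pv) subr_eq0 /= => /eqP <-; exact: hfull.
pose good0 ef := good ef && (cp ef.1 == cp ef.2).
pose W := [set v | `[< exists u s, [/\ u \in Z, p u = 0, walk src dst good0 u s
                                     & walk_end dst u s = v] >]].
have ZW v : v \in Z -> v \notin W -> p v != 0.
  move=> vZ; apply: contra => /eqP pv; rewrite inE; apply/asboolP.
  by exists v, [::].
have WZ v : v \in W -> v \notin Z -> h v = k%:R.
  rewrite inE => /asboolP[u [s [uZ pu ws sv]]] vZ.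
  have [/eqP fv|nfull] := boolP (full v); first by rewrite /h fv.
  have pv : p v = 0 by apply/eqP; apply: contraNT nfull => /pfull.
  have wgood : walk src dst good u s by apply: sub_walk ws => ef /andP[].
  have [|_] := optimum_walk wgood; first by right; rewrite sv.
  have -> : \sum_(ef <- s) len ef = 0.
    rewrite -[RHS](subrr 0) -[X in X - _]pu -[X in _ - X]pv -sv -opprB.
    rewrite -(walk_telescope p ws) -sumrN big_seq [RHS]big_seq.
    apply: eq_bigr => ef /(walk_good ws) /andP[_ /eqP].
    by rewrite /cp /len /src /dst; lra.
  (* A chain member containing [v] is not inside [Z], so it contains [Z] and [u]; moreover [Z]
     contains [u] but not [v]. Hence [omega v < omega u], against optimality along the walk. *)
  move=> /(_ erefl); rewrite sv !omegaE ler_nat leqNgt => /negP[].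
  apply: proper_card; apply/properP; split.
    apply/subsetP => X; rewrite !inE => /andP[XC vX]; rewrite XC /=.
    have /orP[/subsetP XZ|/subsetP->//] := chainC _ _ XC ZC.
    by rewrite XZ in vZ.
  by exists Z; rewrite !inE ZC.
have Wle : \sum_(v in W) h v <= \sum_(v in W) h' v.
  (* Adding weight [d] on heads in [W] keeps [F] locally optimal: exchanges preserving [cp] do not
     leave [W], and the others have a gap of at least [d]. *)
  have [d d0 dP] := uniform_gap (fun ef : A * A => cp ef.2 - cp ef.1).
  have gE (G : {set A}) : \sum_v (p v + d * (v \in W)%:R) * #|G :&: star hd v|%:R =
      \sum_v p v * #|G :&: star hd v|%:R + d * \sum_(v in W) #|G :&: star hd v|%:R.
    rewrite mulr_sumr [X in _ + X]big_mkcond -big_split /=; apply: eq_bigr => v _.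
    by rewrite mulrDl; case: (v \in W); rewrite ?mulr1 ?mulr0 ?mul0r.
  have := @base_local_opt _ _ (fun e => c e + (p (hd e) + d * (hd e \in W)%:R)) FB F'B.
  rewrite !(split_weight (fun v => p v + d * (v \in W)%:R)) !gE cF' lerD2l => le.
  have {le} : \sum_v p v * h v + d * \sum_(v in W) h v <=
              \sum_v p v * h' v + d * \sum_(v in W) h' v.
    apply: le => ef gef; have := pgood _ gef; rewrite le_eqVlt !addrA => /orP[eqp|ltp].
      rewrite (eqP eqp) lerD2l ler_pM2l // ler_nat.
      case eW: (hd ef.1 \in W) => //; suff -> : hd ef.2 \in W by [].
      move: eW; rewrite !inE => /asboolP[u [s [uZ pu ws sv]]]; apply/asboolP.
      exists u, (s ++ [:: ef]); split=> //; last by rewrite walk_end_cat.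
      by rewrite walk_cat ws sv /= /good0 /cp /good gef eqp /src eqxx.
    have := dP ef; rewrite subr_gt0 => /(_ ltp); rewrite /cp.
    by case: (hd ef.1 \in W); case: (hd ef.2 \in W); rewrite ?mulr1 ?mulr0; lra.
  have : \sum_v p v * h' v <= \sum_v p v * h v.
    by apply: ler_sum => v _; rewrite -subr_ge0 -mulrBr.
  by move=> ph' ph; rewrite -(ler_pM2l d0); lra.
rewrite -(ler_nat R) !natr_sum -/h -/h'.
have ZE (phi : V -> R) :
    \sum_(v in Z) phi v = \sum_(v in W :&: Z) phi v + \sum_(v in Z :\: W) phi v.
  by rewrite (@big_setID _ _ _ _ Z W) /= setIC.
have WE (phi : V -> R) :
    \sum_(v in W) phi v = \sum_(v in W :&: Z) phi v + \sum_(v in W :\: Z) phi v.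
  by rewrite (@big_setID _ _ _ _ W Z).
have ZWle : \sum_(v in Z :\: W) h v <= \sum_(v in Z :\: W) h' v.
  by apply: ler_sum => v; rewrite inE => /andP[vW vZ]; rewrite hfull ?h'full ?ZW.
have WZle : \sum_(v in W :\: Z) h' v <= \sum_(v in W :\: Z) h v.
  by apply: ler_sum => v; rewrite inE => /andP[vZ vW]; rewrite WZ.
by move: Wle; rewrite !ZE !WE; lra.
Qed.

End Optimum.

Lemma chain_optimum (c : A -> R) (CC : {set {set V}}) :
    set_chain CC -> (exists F, feasible F) ->
  exists F, [/\ feasible F,
    forall F', feasible F' -> \sum_(e in F) c e <= \sum_(e in F') c e
  & forall F', feasible F' -> \sum_(e in F') c e = \sum_(e in F) c e ->
    forall Z, Z \in CC ->
    (\sum_(v in Z) #|F :&: star hd v| <= \sum_(v in Z) #|F' :&: star hd v|)%N].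
Proof.
move=> chainC [F0 /asboolP feas0].
pose omega v : R := #|[set Z in CC | v \in Z]|%:R.
case: (@arg_minP _ _ _ F0 (fun F => `[< feasible F >]) (fun F => \sum_(e in F) c e) feas0).
move=> F1 feas1 min1.
case: (@arg_minP _ _ _ F1
  (fun F => `[< feasible F >] && (\sum_(e in F) c e == \sum_(e in F1) c e))
  (fun F => \sum_(e in F) omega (hd e))); first by rewrite feas1 eqxx.
move=> F /andP[/asboolP feasF /eqP cF] minF; exists F; split=> // [F' /asboolP/min1|].
  by rewrite cF.
apply: (optimum_chain feasF (omega := omega)) => // F' /asboolP feasF'.
split; first by rewrite cF min1.
by move=> cF'; apply: minF; rewrite feasF' cF' cF eqxx.
Qed.

End Exchanges.

(** * Spanning arborescences and graphic rank *)

Section GraphicRank.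
Variables (V A : finType) (D : digraph V A).
Implicit Types (B T U F : {set A}) (u v : V) (X Y W : {set V}).

Definition vertex_vec (v : V) : 'rV[rat]_#|V| := delta_mx 0 (enum_rank v).

(** Signed incidence vectors represent the graphic matroid over [rat]; its rank inherits
    submodularity from the dimension formula. *)
Definition edge_span B : {vspace 'rV[rat]_#|V|} :=
  (\sum_(a in B) <[vertex_vec (tail D a) - vertex_vec (head D a)]>)%VS.

Definition graphic_rank B : nat := \dim (edge_span B).

Lemma edge_spanS B T : B \subset T -> (edge_span B <= edge_span T)%VS.
Proof.
by move=> /subsetP BT; apply/subv_sumP => a aB; apply: sumv_sup (BT a aB) (subvv _).
Qed.

Lemma graphic_rank0 : graphic_rank set0 = 0%N.
Proof. by rewrite /graphic_rank /edge_span big_set0 dimv0. Qed.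

Lemma graphic_rankS B T : B \subset T -> (graphic_rank B <= graphic_rank T)%N.
Proof. by move=> BT; apply/dimvS/edge_spanS. Qed.

Lemma graphic_rank_card B : (graphic_rank B <= #|B|)%N.
Proof.
rewrite -sum1_card; apply: leq_trans (dimv_leq_sum _ _ _) _.
by apply: leq_sum => a _; rewrite dim_vline leq_b1.
Qed.

Lemma edge_spanU B T : (edge_span (B :|: T) <= edge_span B + edge_span T)%VS.
Proof.
apply/subv_sumP => a /setUP[aB|aT].
  exact: subv_trans (sumv_sup a aB (subvv _)) (addvSl _ _).
exact: subv_trans (sumv_sup a aT (subvv _)) (addvSr _ _).
Qed.

Lemma graphic_rankIU B T :
  (graphic_rank (B :&: T) + graphic_rank (B :|: T) <= graphic_rank B + graphic_rank T)%N.
Proof.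
rewrite /graphic_rank -[leqRHS]dimv_sum_cap addnC leq_add ?dimvS ?edge_spanU //.
by rewrite subv_cap !edge_spanS ?subsetIl ?subsetIr.
Qed.

(** The vectors of arcs inside [X] are spanned by the [#|X| - 1] differences with a fixed vertex
    [x]. *)
Lemma graphic_rank_inner X T : (forall a, a \in T -> (tail D a \in X) && (head D a \in X)) ->
  (0 < #|X|)%N -> (graphic_rank T < #|X|)%N.
Proof.
move=> TX /card_gt0P[x xX]; rewrite (cardsD1 x) xX ltnS.
pose S := (\sum_(v in X :\ x) <[vertex_vec v - vertex_vec x]>)%VS.
apply: (@leq_trans (\dim S)); last first.
  rewrite -sum1_card; apply: leq_trans (dimv_leq_sum _ _ _) _.
  by apply: leq_sum => a _; rewrite dim_vline leq_b1.
have inS v : v \in X -> vertex_vec v - vertex_vec x \in S.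
  move=> vX; have [->|vx] := eqVneq v x; first by rewrite subrr mem0v.
  by apply/(subvP (sumv_sup v _ (subvv _))); rewrite ?memv_line // !inE vx.
apply/dimvS/subv_sumP => a /TX /andP[tX hX]; rewrite -memvE.
rewrite -(subrKA (vertex_vec x)) -(opprB (vertex_vec (head D a))).
by rewrite memvB ?inS.
Qed.

Lemma joins_edge_span B a u v : a \in B -> joins D a u v ->
  vertex_vec u - vertex_vec v \in edge_span B.
Proof.
move=> aB; have aS : vertex_vec (tail D a) - vertex_vec (head D a) \in edge_span B.
  by apply: (subvP (sumv_sup a aB (subvv _))); rewrite memv_line.
by case/orP=> /andP[/eqP<- /eqP<-] //; rewrite -opprB memvN.
Qed.

Lemma path_edge_span B u p : path (adjacent D B) u p ->
  vertex_vec u - vertex_vec (last u p) \in edge_span B.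
Proof.
elim: p u => [|v p IHp] u /=; first by rewrite subrr mem0v.
move=> /andP[/exists_inP[a aB auv] /IHp vp].
by rewrite -(subrKA (vertex_vec v)) memvD // (joins_edge_span aB).
Qed.

(** Incidence vectors telescope along paths, so adjoining the single vector of [x] spans the whole
    space. *)
Lemma connected_graphic_rank B : connected_arcs D B -> (#|V| <= (graphic_rank B).+1)%N.
Proof.
move=> [/card_gt0P[x _] conn].
have full : (fullv <= edge_span B + <[vertex_vec x]>)%VS.
  apply/subvP => y _; have -> : y = \sum_v y 0 (enum_rank v) *: vertex_vec v.
    rewrite {1}(row_sum_delta y) (reindex_onto (@enum_rank V) enum_val) /=; last first.
      by move=> i _; rewrite enum_valK.
    by apply: eq_big => // v; rewrite enum_rankK eqxx.
  apply: memv_suml => v _; apply: memvZ; rewrite -(subrK (vertex_vec x) (vertex_vec v)).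
  apply: memv_add; last exact: memv_line.
  by have /connectP[p pB ->] := conn v x; exact: path_edge_span.
have := dimvS full; rewrite dimvf /dim /= mul1n => /leq_trans; apply.
apply: leq_trans (dimv_add_leqif _ _) _.
rewrite -[leqRHS]addn1 leq_add // dim_vline; exact: leq_b1.
Qed.

Lemma indegree_sum B X :
  (\sum_(v in X) indegree D B v = #|[set a in B | head D a \in X]|)%N.
Proof.
rewrite -sum1_card (partition_big (head D) (mem X)) /= => [|a]; last by rewrite inE => /andP[].
apply: eq_bigr => v vX; rewrite /indegree -sum1_card; apply: eq_bigl => a.
by rewrite !inE; case: eqP => [->|]; rewrite ?vX ?andbF ?andbT.
Qed.

Lemma indegree_total B : (\sum_v indegree D B v = #|B|)%N.
Proof.
rewrite -big_setT indegree_sum; apply: eq_card => a.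
by rewrite !inE andbT.
Qed.

(* If every vertex were entered by an arc, walking backwards would close a cycle. *)
Lemma spanning_tree_source B : spanning_tree D B -> exists v, is_root D B v.
Proof.
move=> [[/card_gt0P[x _] _] acyc]; apply/existsP; apply: contraT => /existsPn noroot; exfalso.
have ex v : {a | (a \in B) && (head D a == v)}.
  by apply/sigW; have := noroot v; rewrite -lt0n => /card_gt0P[a]; rewrite inE; exists a.
pose ent v := sval (ex v); pose f v := tail D (ent v).
have entB v : ent v \in B by have /andP[] := svalP (ex v).
have entK v : head D (ent v) = v by have /andP[_ /eqP] := svalP (ex v).
have [y fy] : exists y, fcycle f (orbit f y).
  have /loopingP/(_ (order f x))/trajectP[i iN iE] := looping_order f x.
  exists (iter i f x); apply/(orbitPcycle 0 3); exists (order f x - i).-1.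
  by rewrite prednK ?subn_gt0 // -iterD subnK // ltnW.
apply: (acyc [seq (v, ent v) | v <- orbit f y]); split.
- by rewrite -size_eq0 size_map size_orbit -lt0n order_gt0.
- by rewrite -map_comp map_id orbit_uniq.
- by rewrite -map_comp map_inj_uniq ?orbit_uniq // => u v /(congr1 (head D)); rewrite /= !entK.
- by rewrite all_map; apply/allP => v _ /=.
- rewrite cycle_map; apply: sub_cycle fy => u v /= /eqP <-.
  by rewrite /joins entK !eqxx orbT.
Qed.

(** [#|V| <= graphic_rank B + 1 <= #|B| + 1 <= #|V|], the last step by summing in-degrees in the
    presence of a root. *)
Lemma spanning_arborescence_rank B : spanning_arborescence D B ->
  #|B|.+1 = #|V| /\ graphic_rank B = #|B|.
Proof.
move=> [treeB in1]; have [v v0] := spanning_tree_source treeB.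
have := connected_graphic_rank treeB.1; have := graphic_rank_card B; move: v0 => /eqP v0.
have : (#|B| < #|V|)%N.
  rewrite -indegree_total (bigD1 v) //= v0 add0n -sum1_card [X in (_ < X)%N](bigD1 v) //=.
  by rewrite ltnS leq_sum.
lia.
Qed.

Lemma spanning_arborescence_free B U : spanning_arborescence D B -> U \subset B ->
  graphic_rank U = #|U|.
Proof.
move=> /spanning_arborescence_rank[_ rB] UB; apply/eqP; rewrite eqn_leq graphic_rank_card /=.
have := graphic_rankIU U (B :\: U); have := graphic_rank_card (B :\: U).
have := setID B U; rewrite (setIidPr UB) => ->.
by rewrite rB (cardsD B U) (setIidPr UB); have := subset_leq_card UB; lia.
Qed.

(** An arc [a] of a cycle is spanned by the other arcs, so the rank would be at most [#|B| - 1], too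
    small for connectivity. *)
Lemma spanning_arborescence_intro B : connected_arcs D B -> (#|B| < #|V|)%N ->
  (forall v, indegree D B v <= 1)%N -> spanning_arborescence D B.
Proof.
move=> connB ltBV in1; split=> //; split=> // -[|[v a] s]; first by case.
move=> [_ _ /andP[/= aS _] /andP[/= aB /allP sB] /= cyc].
suff : (graphic_rank B <= #|B :\ a|)%N.
  have := connected_graphic_rank connB; rewrite (cardsD1 a B) aB in ltBV *; lia.
apply: leq_trans (graphic_rank_card _); apply: dimvS; apply/subv_sumP => b bB.
have [->|ba] := eqVneq b a; last by apply: (sumv_sup b); rewrite ?inE ?ba ?bB.
have walk_in x t : x.2 != a -> {in t, forall y, y.2 \in B :\ a} -> x.2 \in B :\ a ->
    path (fun x y : V * A => joins D x.2 x.1 y.1) x (rcons t (v, a)) ->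
    vertex_vec x.1 - vertex_vec v \in edge_span (B :\ a).
  elim: t x => [|y t IHt] x xa tB xB /=.
    by rewrite andbT => /(joins_edge_span xB).
  move=> /andP[/(joins_edge_span xB) xy /IHt yv].
  rewrite -(subrKA (vertex_vec y.1)) memvD //.
  have yB : y.2 \in B :\ a by apply: tB; rewrite mem_head.
  by apply: yv => // [|z zt]; [case/setD1P: yB|apply: tB; rewrite inE zt orbT].
have sB' : {in s, forall y, y.2 \in B :\ a}.
  move=> y ys; rewrite !inE sB // andbT; apply: contraNneq aS => <-.
  exact: map_f.
rewrite -memvE.
suff [w aw wS] : exists2 w, joins D a v w & vertex_vec w - vertex_vec v \in edge_span (B :\ a).
  case/orP: aw => /andP[/eqP-> /eqP->] //.
  by rewrite -opprB memvN.
case: s sB' cyc {sB aS} => [|y s] sB' /=.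
  by rewrite andbT => avv; exists v => //; rewrite subrr mem0v.
move=> /andP[avy ys]; exists y.1 => //.
have yB : y.2 \in B :\ a by apply: sB'; rewrite mem_head.
apply: walk_in ys => // [|z zs]; first by case/setD1P: yB.
by apply: sB'; rewrite inE zs orbT.
Qed.

End GraphicRank.

(** * The rank function of a k-fold matroid union *)

Section UnionRank.
Local Open Scope nat_scope.
Variables (A : finType) (k : nat) (rk : {set A} -> nat).
Hypothesis rk0 : rk set0 = 0%N.
Hypothesis rkS : forall T U : {set A}, T \subset U -> rk T <= rk U.
Hypothesis rkIU : forall T U : {set A}, rk (T :&: U) + rk (T :|: U) <= rk T + rk U.
Implicit Types T U : {set A}.

(** The min-max formula for the rank of the [k]-fold union, taken as the definition. *)
Definition union_rank T : nat :=
  let U := [arg min_(U < set0 | U \subset T) (k * rk U + #|T :\: U|)] in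
  k * rk U + #|T :\: U|.

Lemma union_rankP T : exists2 U : {set A}, U \subset T & union_rank T = k * rk U + #|T :\: U|.
Proof. by rewrite /union_rank; case: arg_minnP => [|U UT _]; [exact: sub0set|exists U]. Qed.

Lemma union_rank_le T (U : {set A}) : U \subset T -> union_rank T <= k * rk U + #|T :\: U|.
Proof.
by move=> UT; rewrite /union_rank; case: arg_minnP => [|W _]; [exact: sub0set|apply].
Qed.

Lemma union_rank0 : union_rank set0 = 0.
Proof.
have := union_rank_le (subxx set0); rewrite rk0 muln0 setDv cards0.
by rewrite leqn0 => /eqP.
Qed.

Lemma union_rank1 e : union_rank [set e] <= 1.
Proof.
by have := union_rank_le (sub0set [set e]); rewrite rk0 muln0 setD0 cards1.
Qed.

Lemma union_rankS T U : T \subset U -> union_rank T <= union_rank U.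
Proof.
move=> TU; have [W WU ->] := union_rankP U.
apply: leq_trans (union_rank_le (subsetIl T W)) _.
rewrite leq_add ?leq_mul2l ?rkS ?subsetIr ?orbT // subset_leq_card //.
by rewrite setDIr setDv set0U setSD.
Qed.

(** The intersection and union of the two minimizers are candidates on the left; [rk] is submodular
    and cardinality is modular. *)
Lemma union_rankIU T U :
  union_rank (T :&: U) + union_rank (T :|: U) <= union_rank T + union_rank U.
Proof.
have [T' T'T ->] := union_rankP T; have [U' U'U ->] := union_rankP U.
have := union_rank_le (setISS T'T U'U); have := union_rank_le (setUSS T'T U'U).
have := leq_mul (leqnn k) (rkIU T' U'); rewrite !mulnDr.
rewrite !cardsD (setIidPr T'T) (setIidPr U'U).
rewrite (setIidPr (setISS T'T U'U)) (setIidPr (setUSS T'T U'U)).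
have := cardsUI T U; have := cardsUI T' U'.
have := subset_leq_card T'T; have := subset_leq_card U'U.
have := subset_leq_card (setISS T'T U'U); have := subset_leq_card (setUSS T'T U'U).
lia.
Qed.

End UnionRank.

(** * Packing arborescences *)

Section Packing.
Local Open Scope nat_scope.
Variables (V A : finType) (D : digraph V A).
Implicit Types (B F : {set A}) (q : V -> nat) (u v s : V) (X Y W : {set V}).

Definition entering F X : {set A} := [set a in F | (head D a \in X) && (tail D a \notin X)].

Lemma enteringIU F X Y : #|entering F (X :&: Y)| + #|entering F (X :|: Y)| <=
  #|entering F X| + #|entering F Y|.
Proof.
rewrite -cardsUI -[leqRHS]cardsUI leq_add // subset_leq_card //;
  apply/subsetP => a; rewrite !inE;
  by case: (a \in F) (head D a \in X) (head D a \in Y) (tail D a \in X) (tail D a \in Y)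
    => [] [] [] [] [].
Qed.

Lemma entering_inner F X :
  \sum_(v in X) indegree D F v =
  #|[set a in F | (tail D a \in X) && (head D a \in X)]| + #|entering F X|.
Proof.
rewrite indegree_sum -cardsUI [X in _ + X](_ : _ = 0) ?addn0.
  apply: eq_card => a; rewrite !inE.
  by case: (a \in F) (head D a \in X) (tail D a \in X) => [] [] [].
apply/eqP; rewrite cards_eq0; apply/eqP/setP => a; rewrite !inE.
by case: (a \in F) (head D a \in X) (tail D a \in X) => [] [] [].
Qed.

Lemma entering_setD1 F X a : a \in F ->
  #|entering F X| = ((head D a \in X) && (tail D a \notin X)) + #|entering (F :\ a) X|.
Proof.
move=> aF; rewrite (cardsD1 a) !inE aF; congr (_ + _); apply: eq_card => b.
by rewrite !inE andbA.
Qed.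

Lemma indegree_setU1 B a v : a \notin B ->
  indegree D (a |: B) v = (head D a == v) + indegree D B v.
Proof.
move=> aB; rewrite /indegree (cardsD1 a) !inE eqxx /=; congr (_ + _); apply: eq_card => b.
by rewrite !inE; case: eqP => [->|] //=; rewrite (negbTE aB).
Qed.

Lemma adjacentS B F : B \subset F -> subrel (adjacent D B) (adjacent D F).
Proof.
by move=> /subsetP BF u v /exists_inP[a aB auv]; apply/exists_inP; exists a => //; apply: BF.
Qed.

Lemma adjacent_sym B : symmetric (adjacent D B).
Proof.
by move=> u v; apply/exists_inP/exists_inP => -[a aB]; rewrite /joins orbC; exists a.
Qed.

(** * Splitting one arborescence off a packing *)

Section PeelOne.
Variables (k : nat) (q : V -> nat) (F : {set A}) (s : V).
Hypothesis q_total : \sum_v q v = k.+1.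
Hypothesis cut : forall X, X != set0 -> k < \sum_(v in X) q v + #|entering F X|.
Hypothesis qs : 0 < q s.

(** The last clause is the cut condition for packing [k] further arborescences in [F :\: B], with
    the demand at [s] lowered by one, written without subtraction. *)
Definition partial_branching W B : Prop :=
  [/\ B \subset F, forall a, a \in B -> (tail D a \in W) && (head D a \in W),
      forall v, v \in W -> connect (adjacent D B) s v & forall v, indegree D B v = (v \in W :\ s)]
  /\ s \in W /\
  forall X, X != set0 -> k + (s \in X) <= \sum_(v in X) q v + #|entering (F :\: B) X|.

(* A minimal set tight for F \ B and not inside W contains the head and the
   tail of an arc leaving W; by submodularity no tight set is entered by it. *)
Lemma branching_extension W B : partial_branching W B -> W != [set: V] ->
  exists a, [/\ a \notin B, tail D a \in W, head D a \notin W
              & partial_branching (head D a |: W) (a |: B)].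
Proof.
move=> [[BF BW Wconn Bdeg] [sW Bcut]] WV.
pose f X := \sum_(v in X) q v + #|entering (F :\: B) X|.
have qT X Y : \sum_(v in X) q v = \sum_(v in X :&: Y) q v + \sum_(v in X :\: Y) q v.
  exact: (@big_setID _ _ _ _ X Y).
pose P X := ~~ (X \subset W) && (f X == k + (s \in X)).
have PT : P [set: V].
  rewrite /P subTset WV inE /f big_setT q_total.
  rewrite (_ : entering _ _ = set0) ?cards0 ?addn0 ?addn1 ?eqxx //.
  by apply/setP => a; rewrite !inE andbF.
have [X /andP[XW /eqP fX] Xmin] := arg_minnP (fun X : {set V} => #|X|) PT.
have XW0 : X :\: W != set0 by rewrite setD_eq0.
(* Arcs of [B] do not enter [X :\: W], so the stronger condition [cut] applies there and forces an
   arc from [X :&: W] to [X :\: W]. *)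
have enter_out : #|entering (F :\: B) (X :\: W)| = #|entering F (X :\: W)|.
  apply: eq_card => a; rewrite !inE; case aB: (a \in B) => //=.
  by have /andP[_ ->] := BW a aB; rewrite /= andbF.
have [a]: exists a, [&& a \in F :\: B, tail D a \in X :&: W & head D a \in X :\: W].
  apply/existsP; apply: contraT => /existsPn none.
  have := cut XW0; rewrite -enter_out.
  have /subset_leq_card : entering (F :\: B) (X :\: W) \subset entering (F :\: B) X.
    apply/subsetP => a; have := none a; rewrite !inE.
    by case: (a \in B) (a \in F) (tail D a \in X) (tail D a \in W) (head D a \in X)
      (head D a \in W) => [] [] [] [] [] [].
  have : \sum_(v in X :\: W) q v + (s \in X) <= \sum_(v in X) q v.
    rewrite (qT X W) addnC leq_add2r; case sX: (s \in X) => //.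
    by rewrite (bigD1 s) /= ?inE ?sX // ltn_addr.
  by move: fX; rewrite /f; lia.
rewrite !inE => /and3P[/andP[aB aF] /andP[tX tW] /andP[hW hX]].
exists a; split=> //; split; split=> //.
- by rewrite subUset sub1set aF.
- move=> b /setU1P[->|/BW/andP[btW bhW]]; first by rewrite !inE eqxx tW orbT.
  by rewrite !inE btW bhW !orbT.
- have stay v : v \in W -> connect (adjacent D (a |: B)) s v.
    move=> /Wconn; apply: connect_sub => x y xy; apply: connect1.
    by apply: adjacentS xy; apply: subsetUr.
  move=> v /setU1P[->|]; last exact: stay.
  apply: connect_trans (stay _ tW) _; apply: connect1; apply/exists_inP; exists a.
    exact: setU11.
  by rewrite /joins !eqxx.
- move=> v; rewrite indegree_setU1 // Bdeg !inE.
  have [<-|hv] := eqVneq (head D a) v; last by rewrite add0n.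
  rewrite (negbTE hW) andbF andbT addn0; case: eqP => // hs.
  by rewrite hs sW in hW.
- by rewrite inE sW orbT.
move=> Y Y0; have aFB : a \in F :\: B by rewrite inE aB.
have := Bcut Y Y0; rewrite (entering_setD1 _ aFB).
have -> : F :\: (a |: B) = (F :\: B) :\ a by rewrite setDDl setUC.
case/boolP: ((head D a \in Y) && (tail D a \notin Y)) => // /andP[hY tY].
have eY := entering_setD1 Y aFB; rewrite hY tY in eY.
rewrite leq_eqVlt => /orP[/eqP fY|]; last by rewrite add1n addnS ltnS.
have XY0 : X :&: Y != set0 by apply/set0Pn; exists (head D a); rewrite inE hX.
have XYU0 : X :|: Y != set0 by apply/set0Pn; exists (head D a); rewrite inE hX.
(* Uncrossing with a tight [Y] entered by [a] makes [X :&: Y] tight; it contains the head of [a] but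
   not its tail, against the minimality of [X]. *)
suff : P (X :&: Y).
  move=> /Xmin; rewrite leqNgt => /negP[]; apply: proper_card; apply/properP.
  by split; [exact: subsetIl|exists (tail D a); rewrite // inE (negbTE tY) andbF].
apply/andP; split.
  by apply/subsetPn; exists (head D a); rewrite // inE hX.
have qIU : \sum_(v in X :&: Y) q v + \sum_(v in X :|: Y) q v =
    \sum_(v in X) q v + \sum_(v in Y) q v := sum_setUI q X Y.
have := Bcut _ XY0; have := Bcut _ XYU0; have := enteringIU (F :\: B) X Y.
move: qIU fX fY; rewrite /f eY in_setI in_setU.
move: (\sum_(v in X :&: Y) q v) (\sum_(v in X :|: Y) q v) => qI qU.
move: (\sum_(v in X) q v) (\sum_(v in Y) q v) => qX qY.
move: #|entering _ (X :&: Y)| #|entering _ (X :|: Y)| #|entering _ X| => eI eU eX.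
by move: #|_|; case: (s \in X) (s \in Y) => [] [] /= eY'; clear; lia.
Qed.

Lemma peel_branching :
  exists2 B : {set A}, partial_branching [set: V] B & spanning_arborescence D B.
Proof.
have start : partial_branching [set s] set0.
  split; [split|split].
  - exact: sub0set.
  - by move=> a; rewrite in_set0.
  - by move=> v /set1P->; exact: connect0.
  - by move=> v; rewrite setDv inE; apply/eqP; rewrite cards_eq0; apply/eqP/setP=> a; rewrite !inE.
  - exact: set11.
  move=> X X0; rewrite setD0; apply: leq_trans (cut X0).
  by rewrite -addn1 leq_add2l leq_b1.
suff [B BP] : exists B, partial_branching [set: V] B.
  exists B => //; have [[BF _ conn deg] _] := BP.
  have sym : connect_sym (adjacent D B) by apply: sym_connect_sym; exact: adjacent_sym.
  apply: spanning_arborescence_intro => [||v]; last by rewrite deg leq_b1.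
    split; first by apply/card_gt0P; exists s.
    by move=> u v; apply: connect_trans (conn v (in_setT v)); rewrite sym conn.
  rewrite -(indegree_total D) (bigD1 s) //= deg !inE eqxx add0n -sum1_card [leqRHS](bigD1 s) //=.
  by rewrite ltnS; apply: leq_sum => v _; rewrite deg leq_b1.
move: start; have [n] := ubnP #|~: [set s]|; elim: n [set s] set0 => // n IHn W B.
rewrite ltnS => lt WB.
have [<-|WV] := eqVneq W [set: V]; first by exists B.
have [a [_ _ aW /IHn]] := branching_extension WB WV; apply.
apply: leq_trans lt; apply: proper_card; apply/properP; split.
  by rewrite setCS subsetUr.
by exists (head D a); rewrite ?inE // eqxx.
Qed.

End PeelOne.

(** Induction on [k]: an arborescence rooted at some [s] of positive demand is split off, and the
    cut condition survives with that demand lowered by one. The exact in-degrees ensure that no arc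
    is left over at the end. *)
Lemma edmonds_disjoint_arborescences k q F :
    \sum_v q v = k -> (forall v, q v + indegree D F v = k) ->
  (forall X, X != set0 -> k <= \sum_(v in X) q v + #|entering F X|) -> k_arborescence D k F.
Proof.
elim: k q F => [|k IHk] q F qk qF cut.
  exists (fun=> set0); split=> [[]//|[]//|]; rewrite big_ord0.
  apply/setP => a; rewrite in_set0; apply/negP => aF.
  have : 0 < indegree D F (head D a) by apply/card_gt0P; exists a; rewrite inE aF eqxx.
  by have := qF (head D a); lia.
have /existsP[s qs] : [exists s, 0 < q s].
  apply: contra_eqT qk => /existsPn q0; rewrite big1 // => v _.
  by apply/eqP; rewrite -leqn0 leqNgt.
have [B [[BF _ _ Bdeg] [_ Bcut]] arbB] := peel_branching qk cut qs.
pose q' v := q v - (v == s).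
have q'E v : q v = q' v + (v == s) by rewrite subnK //; case: eqP => [->|].
have q'sum X : \sum_(v in X) q v = \sum_(v in X) q' v + (s \in X).
  rewrite (eq_bigr _ (fun v _ => q'E v)) big_split /=; congr (_ + _).
  rewrite -[RHS]natn -(sum_indicator nat).
  by apply: eq_bigr => v _; rewrite natn.
have degF v : indegree D F v = (v != s) + indegree D (F :\: B) v.
  have := Bdeg v; rewrite /indegree !inE andbT => <-.
  rewrite -(cardsID B [set a in F | head D a == v]); congr (_ + _); apply: eq_card => a.
    rewrite !inE andbC andbA; case aB: (a \in B) => //=.
    by rewrite (subsetP BF _ aB).
  by rewrite !inE andbA.
have [|v|X X0|B' [arbB' disjB' defB']] := IHk q' (F :\: B).
- by have := q'sum [set: V]; rewrite !big_setT qk inE addn1 => -[].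
- by have := qF v; rewrite q'E degF; case: eqP => /=; lia.
- by have := Bcut X X0; rewrite q'sum; lia.
exists (fun i => if unlift ord0 i is Some j then B' j else B); split.
- by move=> i; case: unliftP.
- move=> i j; case: unliftP => [i' ->|->]; case: unliftP => [j' ->|->] //=.
  + by rewrite (inj_eq lift_inj); exact: disjB'.
  + move=> _; apply/pred0P => a /=; apply/negP => /andP[aB' aB].
    have : a \in F :\: B by rewrite defB'; apply/bigcupP; exists i'.
    by rewrite inE aB.
  + move=> _; apply/pred0P => a /=; apply/negP => /andP[aB aB'].
    have : a \in F :\: B by rewrite defB'; apply/bigcupP; exists j'.
    by rewrite inE aB.
- rewrite big_ord_recl unlift_none; under eq_bigr do rewrite liftK.
  by rewrite -defB' -{1}(setIidPr BF) setID.
Qed.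

Lemma decomposition_indegree k F (B : 'I_k -> {set A}) v : arborescence_decomposition D F B ->
  indegree D F v = \sum_i indegree D (B i) v.
Proof.
move=> [_ disjB ->]; rewrite /indegree.
have -> : [set a in \bigcup_i B i | head D a == v] = \bigcup_i [set a in B i | head D a == v].
  apply/setP => a; rewrite inE; apply/andP/bigcupP => [[/bigcupP[i _ aB] av]|[i _]].
    by exists i; rewrite // inE aB.
  by rewrite inE => /andP[aB ->]; split=> //; apply/bigcupP; exists i.
rewrite -sum1_card partition_disjoint_bigcup /=.
  by apply: eq_bigr => i _; rewrite sum1_card.
move=> i j ij; have := disjB i j ij; rewrite -!setI_eq0 => /eqP/setP BB.
apply/eqP/setP => a; have := BB a; rewrite !inE.
by case: (a \in B i) => //=; case: (a \in B j); rewrite //= andbF.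
Qed.

(** In each member, [v] is either the root or entered by exactly one arc. Hence the root vector
    depends on [F] alone. *)
Lemma decomposition_roots k F (B : 'I_k -> {set A}) v : arborescence_decomposition D F B ->
  #|[set i | is_root D (B i) v]| + indegree D F v = k.
Proof.
move=> FB; rewrite (decomposition_indegree v FB) -sum1_card big_mkcond -big_split /=.
rewrite -[RHS]card_ord -sum1_card; apply: eq_bigr => i _; rewrite inE /is_root.
have [arbB _ _] := FB; have [_ /(_ v)] := arbB i.
by case: indegree => [|[|]].
Qed.

Definition arborescence_rank k : {set A} -> nat := union_rank k (graphic_rank D).

Lemma k_arborescence_card k F : k_arborescence D k F -> #|F| + k = k * #|V|.
Proof.
move=> [B FB].
have rootsE : \sum_v #|[set i | is_root D (B i) v]| = k.
  have [arbB _ _] := FB; rewrite -[RHS]card_ord -sum1_card.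
  under eq_bigr do rewrite -sum1_card big_mkcond.
  rewrite exchange_big; apply: eq_bigr => i _ /=.
  have [cB _] := spanning_arborescence_rank (arbB i).
  apply: (@addIn #|B i|); rewrite add1n cB -(indegree_total D) -big_split /= -sum1_card.
  apply: eq_bigr => v _; rewrite inE /is_root.
  by have [_ /(_ v)] := arbB i; case: indegree => [|[|]].
rewrite -(indegree_total D) -[X in _ + X]rootsE -big_split mulnC -sum_nat_const /=.
by apply: eq_bigr => v _; rewrite addnC (decomposition_roots v FB).
Qed.

(** Each member is free in the graphic matroid, so it meets the minimizing [U] in at most
    [graphic_rank D U] arcs. *)
Lemma k_arborescence_rank k F T : k_arborescence D k F -> #|F :&: T| <= arborescence_rank k T.
Proof.
move=> [B [arbB _ ->]]; rewrite /arborescence_rank.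
have [U UT ->] := union_rankP k (graphic_rank D) T.
set G := \bigcup_i B i; apply: (@leq_trans (#|G :&: U| + #|T :\: U|)).
  apply: leq_trans (leq_card_setU _ _); apply/subset_leq_card/subsetP => a.
  by rewrite !inE => /andP[-> ->]; rewrite /= andbT orbN.
rewrite leq_add2r; have -> : G :&: U = \bigcup_i (B i :&: U).
  by rewrite /G big_distrl.
apply: (@leq_trans (\sum_(i < k) #|B i :&: U|)).
  elim/big_rec2: _ => [|i n Y _ le]; first by rewrite cards0.
  by apply: leq_trans (leq_card_setU _ _) _; rewrite leq_add2l.
rewrite -[k in k * _]card_ord -sum_nat_const; apply: leq_sum => i _.
rewrite -(spanning_arborescence_free (arbB i) (subsetIl _ _)).
exact/graphic_rankS/subsetIr.
Qed.

Lemma indegreeE F v : indegree D F v = #|F :&: star (head D) v|.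
Proof. by apply: eq_card => a; rewrite !inE. Qed.

(** The given [F0] fixes the rank of the full arc set at [k * (#|V| - 1)]. For feasible [F], the cut
    condition follows by counting arcs with head in [X]: at most [k * (#|X| - 1)] of them have their
    tail in [X] too. *)
Lemma feasible_k_arborescence k F0 F : 0 < k -> k_arborescence D k F0 ->
  feasible (head D) k (arborescence_rank k) F <-> k_arborescence D k F.
Proof.
move=> k0 F0k; have cF0 := k_arborescence_card F0k.
have V0 : 0 < #|V|.
  by have [B [/(_ (Ordinal k0))[[[]]]]] := F0k.
have rk_inner (X : {set V}) (T : {set A}) :
    (forall a, a \in T -> (tail D a \in X) && (head D a \in X)) ->
    X != set0 -> arborescence_rank k T + k <= k * #|X|.
  move=> TX; rewrite -card_gt0 => X0; have := graphic_rank_inner TX X0.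
  have := union_rank_le k (graphic_rank D) (subxx T).
  rewrite setDv cards0 addn0 -/(arborescence_rank k T) => le lt.
  have := leq_mul (leqnn k) lt; rewrite mulnS; lia.
have rkT : arborescence_rank k [set: A] + k = k * #|V|.
  have := k_arborescence_rank [set: A] F0k; rewrite setIT => leF0.
  apply/eqP; rewrite eqn_leq; apply/andP; split; last first.
    by rewrite -cF0 leq_add2r.
  rewrite -[#|V|]cardsT rk_inner //; first by move=> a; rewrite !inE.
  by rewrite -card_gt0 cardsT.
split=> [[Fr FA Fk]|Fk]; last first.
  split=> [T||v]; first exact: k_arborescence_rank.
    by have := k_arborescence_card Fk; lia.
  by have [B FB] := Fk; rewrite -indegreeE -[leqRHS](decomposition_roots v FB) leq_addl.
have qF v : (k - indegree D F v) + indegree D F v = k by rewrite subnK // indegreeE.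
have qsum X : \sum_(v in X) (k - indegree D F v) + \sum_(v in X) indegree D F v = k * #|X|.
  by rewrite -big_split mulnC -sum_nat_const; apply: eq_bigr => v _; rewrite /= qF.
apply: (@edmonds_disjoint_arborescences k (fun v => k - indegree D F v)) => // [|X X0].
  by have := qsum [set: V]; rewrite !big_setT indegree_total cardsT FA; lia.
have := qsum X; rewrite entering_inner; set I := [set a in F | _].
have : #|I| <= arborescence_rank k I.
  by rewrite -{1}(_ : F :&: I = I) //; apply/setIidPr/subsetP => a; rewrite inE => /andP[].
have := rk_inner X I; rewrite X0 => /(_ _ isT) le.
have {le} : arborescence_rank k I + k <= k * #|X| by apply: le => a; rewrite inE => /andP[].
lia.
Qed.

End Packing.

Theorem theorem4p5 (R : realType) (V A : finType) (D : digraph V A) (k : nat)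
    (hk : (0 < k)%N) (c : A -> R) :
  base_polyhedron (convex_hull (min_cost_root_vectors D k c)).
Proof.
have rootE F (q : {ffun V -> R^o}) : root_vector D k F q -> k_arborescence D k F /\
    forall v, q v = k%:R - #|F :&: star (head D) v|%:R.
  move=> [B FB qE]; split=> [|v]; first by exists B.
  by rewrite qE -[X in X%:R - _](decomposition_roots v FB) natrD indegreeE addrK.
apply: (@base_polyhedron_of_chains _ _ _ k%:R).
  move=> q [F _ /rootE[Fk qE]]; under eq_bigr do rewrite qE.
  rewrite sumrB; have -> : \sum_v #|F :&: star (head D) v|%:R = #|F|%:R :> R.
    rewrite -natr_sum -(indegree_total D); congr (_%:R).
    by apply: eq_bigr => v _; rewrite indegreeE.
  rewrite sumr_const -[k%:R *+ _]mulr_natr -natrM.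
  by rewrite -(k_arborescence_card Fk) natrD addrC addKr.
move=> [_ [F0 [F0k _] _]] CC chainC.
have feasE F := feasible_k_arborescence F hk F0k.
have rk0 := @graphic_rank0 _ _ D; have rkS := @graphic_rankS _ _ D.
have rkIU := @graphic_rankIU _ _ D.
have [|F [/feasE Fk Fmin Fchain]] := @chain_optimum R _ _ (head D) k (arborescence_rank D k)
  (union_rank0 k rk0) (union_rank1 k rk0) (union_rankS k rkS) (union_rankIU k rk0 rkIU) c CC chainC.
  by exists F0; apply/feasE.
have [B FB] := Fk.
pose q : {ffun V -> R^o} := [ffun v => #|[set i | is_root D (B i) v]|%:R].
have qF : root_vector D k F q by exists B => // v; rewrite ffunE.
exists q.
  by exists F => //; split=> // F' /feasE; exact: Fmin.
move=> Z q' ZC [F' [F'k F'min] /rootE[_ q'E]]; have [_ qE] := rootE _ _ qF.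
(* A root vector sums over [Z] to [k * #|Z|] minus the total in-degree there, so minimal in-degrees
   give maximal sums. *)
rewrite (eq_bigr _ (fun v _ => qE v)) (eq_bigr _ (fun v _ => q'E v)) !sumrB lerD2l lerN2.
rewrite -!natr_sum ler_nat; apply: Fchain => //; first exact/feasE.
by apply: le_anti; rewrite [_ <= _](F'min F Fk) Fmin //; apply/feasE.
Qed.
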